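(* Fix an integer $\nu\ge1$. (a) For any $p\in(\frac1\nu,\frac2\nu]$ there exist a sequence of ReLU network architectures $\eta_W$ ($\nu$ inputs, $W$ weights) with depths $L=O(W^{p\nu-1})$ and respective weight assignments $f\mapsto$ (weights of $\eta_W$), producing network functions $\widetilde f_W$, such that $$\|f-\widetilde f_W\|_\infty\le a\,\omega_f(cW^{-p})\quad\text{for all } f\in C([0,1]^\nu)\text{ and all } W,$$ with constants $a,c$ (possibly depending on $\nu,p$) independent of $W$ and $f$. (b) For $p=\frac2\nu$, one can take $\eta_W$ to be the narrow fully-connected architectures of constant width $H=2\nu+10$ having $W$ weights. (c) For $p\in(\frac1\nu,\frac2\nu)$, one can take $\eta_W$ to be stacked architectures in which a parallel shallow subnetwork (a collection of parallel blocks, each with the same architecture depending only on $\nu$, receiving the network input) is followed by a narrow fully-connected subnetwork of width $3^\nu(2\nu+10)$ and depth $W^{p\nu-1}$, all remaining weights (out of $W$) being allocated to the blocks of the parallel subnetwork.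
   Context: For $f:[0,1]^\nu\to\mathbb R$ continuous, $\omega_f(r)=\max\{|f(\mathbf x)-f(\mathbf y)|:\mathbf x,\mathbf y\in[0,1]^\nu,\ |\mathbf x-\mathbf y|\le r\}$ (Euclidean norm). A ReLU network is a feed-forward network with $\nu$ input units, hidden units grouped into a sequence of layers (each unit taking inputs from outputs of units in earlier layers), and one output unit. A hidden unit computes $(x_1,\dots,x_s)\mapsto(\sum_kw_kx_k+h)_+$, $t_+=\max(0,t)$; the output unit computes $\sum_kw_kx_k+h$. The depth $L$ is the number of hidden layers; the number of weights $W$ is the number of connections plus the number of computation (hidden and output) units. A weight assignment is a rule choosing all weights of $\eta_W$ depending on $f$ (not required to be continuous), and $\widetilde f_W$ is the resulting network function; $\|\cdot\|_\infty$ is the sup norm on $[0,1]^\nu$. The narrow fully-connected architecture of width $H$ and depth $L$ has $L$ hidden layers of $H$ units each, with full connections between consecutive layers only (inputs to the first hidden layer, last hidden layer to the output); it has $W=L(H^2+H)+H^2+(\nu+1)H+1$ weights. With $H$ fixed, the ''narrow fully-connected architecture of width $H$ having $W$ weights'' is the one whose depth $L$ is determined by this equality; it is assumed that $W$ ranges over values for which this $L$ is an integer.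
   Formalization: In (c) the bound is asserted only for all sufficiently large W (for small W the narrow subnetwork alone exceeds W), the depth W^{pν-1} is rounded down, and the total number of weights is at most W and within a constant of W instead of exactly W. *)

(* Defs.v *)
From HB Require Import structures.
From mathcomp Require Import all_boot all_order all_algebra.
From mathcomp Require Import all_classical all_reals all_analysis.
Set Implicit Arguments. Unset Strict Implicit. Unset Printing Implicit Defensive.
Import Order.TTheory GRing.Theory Num.Theory.
Import numFieldNormedType.Exports.
Local Open Scope classical_set_scope.
Local Open Scope ring_scope.

(* Layers are numbered: 0 = input layer (nu input units),               *)
(* 1..depth = hidden layers, depth+1 = the output unit.                 *)
(* A source (j,k) denotes unit k of layer j.                            *)
(* A hidden layer is a list of units; a unit is the list of its sources *)
(* (its incoming connections).                                          *)
Definition src := (nat * nat)%type.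

Record arch := Arch {
  hidden_layers : seq (seq (seq src));  (* entry l = network layer l+1 *)
  out_srcs : seq src }.

Definition depth (A : arch) : nat := size (hidden_layers A).

Definition layer_size (nu : nat) (A : arch) (j : nat) : nat :=
  if j == 0%N then nu else size (nth [::] (hidden_layers A) j.-1).

Definition wf_arch (nu : nat) (A : arch) : Prop :=
  (forall l, (l < depth A)%N -> forall u, u \in nth [::] (hidden_layers A) l ->
     uniq u /\ forall s, s \in u -> (s.1 <= l)%N /\ (s.2 < layer_size nu A s.1)%N)
  /\ uniq (out_srcs A)
  /\ (forall s, s \in out_srcs A ->
        (s.1 <= depth A)%N /\ (s.2 < layer_size nu A s.1)%N).

(* number of weights = number of connections + number of computation units *)
Definition num_weights (A : arch) : nat :=
  (sumn [seq sumn [seq (size u).+1 | u <- layer] | layer <- hidden_layers A]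
   + (size (out_srcs A)).+1)%N.

(* A weight assignment: wt l k i = weight of the i-th incoming connection
   of unit k of layer l, bias l k = its bias h (output unit: layer depth+1,
   unit 0). *)
Record weights (R : realType) := Weights {
  wt : nat -> nat -> nat -> R;
  bias : nat -> nat -> R }.

Definition relu {R : realType} (t : R) : R := Num.max t 0.

Section Eval.
Variables (R : realType) (nu : nat) (A : arch) (w : weights R).

Definition unit_pre (l k : nat) (srcs : seq src) (vals : seq (seq R)) : R :=
  \sum_(i < size srcs)
     wt w l k i * nth 0 (nth [::] vals (nth (0%N, 0%N) srcs i).1)
                          (nth (0%N, 0%N) srcs i).2
  + bias w l k.

Fixpoint layer_vals (x : 'rV[R]_nu) (l : nat) : seq (seq R) :=
  match l with
  | 0%N => [:: [seq x ord0 i | i <- enum 'I_nu]]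
  | l'.+1 =>
      let prev := layer_vals x l' in
      let layer := nth [::] (hidden_layers A) l' in
      rcons prev (mkseq (fun k => relu (unit_pre l k (nth [::] layer k) prev))
                        (size layer))
  end.

Definition net_fun (x : 'rV[R]_nu) : R :=
  unit_pre (depth A).+1 0 (out_srcs A) (layer_vals x (depth A)).
End Eval.

Definition cube {R : realType} (nu : nat) : set 'rV[R]_nu :=
  [set x | forall i, 0 <= x ord0 i <= 1].

Definition eucl_dist {R : realType} {nu : nat} (x y : 'rV[R]_nu) : R :=
  Num.sqrt (\sum_i (x ord0 i - y ord0 i) ^+ 2).

(* omega_f(r) = max{|f x - f y| : x,y in [0,1]^nu, |x-y| <= r}
   (a maximum for continuous f; written as a sup) *)
Definition modulus {R : realType} {nu : nat} (f : 'rV[R]_nu -> R) (r : R) : R :=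
  sup [set t | exists x y, @cube R nu x /\ @cube R nu y /\ eucl_dist x y <= r
                          /\ t = `|f x - f y|].

Definition approx_bound {R : realType} (nu : nat) (A : arch)
  (assign : ('rV[R]_nu -> R) -> weights R) (a c : R) (W : nat) (p : R) : Prop :=
  forall f : 'rV[R]_nu -> R, {within @cube R nu, continuous f} ->
  forall x, @cube R nu x ->
    `|f x - @net_fun R nu A (assign f) x| <= a * modulus f (c * powR (W%:R) (- p)).

Definition fc_arch (nu H L : nat) : arch :=
  Arch (mkseq (fun l => nseq H (if l == 0%N then [seq (0%N, k) | k <- iota 0 nu]
                                else [seq (l, k) | k <- iota 0 H])) L)
       [seq (L, k) | k <- iota 0 H].

(* the weight count used in the paper to index this architecture *)
Definition fc_W (nu H L : nat) : nat :=
  (L * (H ^ 2 + H) + H ^ 2 + (nu + 1) * H + 1)%N.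

(* A block B is a list of layers of units whose sources (j,k) refer to  *)
(* the network input (j = 0) or to unit k of the block's own layer j.   *)
(* The parallel subnetwork consists of m copies of B placed side by     *)
(* side (all receiving the network input); it is followed by a narrow   *)
(* fully-connected subnetwork of width H and depth L >= 1: its first    *)
(* layer [glue] (H units) receives connections from earlier units,      *)
(* consecutive FC layers are fully connected, and the output unit is    *)
(* fully connected to the last FC layer.                                *)
Definition block := seq (seq (seq src)).

Definition shift_src (B : block) (c : nat) (s : src) : src :=
  if s.1 == 0%N then s
  else (s.1, (s.2 + c * size (nth [::] B s.1.-1))%N).

Definition parallel_layers (B : block) (m : nat) : seq (seq (seq src)) :=
  mkseq (fun j => flatten [seq [seq map (shift_src B c) u | u <- nth [::] B j]
                          | c <- iota 0 m]) (size B).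

Definition stack_arch (B : block) (m H L : nat) (glue : seq (seq src)) : arch :=
  let d := size B in
  Arch (parallel_layers B m ++
          glue :: mkseq (fun l => nseq H [seq ((d + l.+1)%N, k) | k <- iota 0 H]) L.-1)
       [seq ((d + L)%N, k) | k <- iota 0 H].

Arguments approx_bound {R} nu A assign a c W p.
Arguments net_fun {R} nu A w x.
Arguments modulus {R nu} f r.

(* Main.v *)
Require Import Defs.
From HB Require Import structures.
From mathcomp Require Import all_boot all_order all_algebra.
From mathcomp Require Import all_classical all_reals all_analysis.
From mathcomp Require Import zify ring lra.
Import Order.TTheory GRing.Theory Num.Theory.
Import numFieldNormedType.Exports.
Local Open Scope classical_set_scope.
Local Open Scope ring_scope.

(* Cut the cube into N^nu cells and each cell into P^nu subcells, and put
   lambda = omega_f(c W^-p), which bounds the variation of f over neighbouring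
   subcells. Along a walk through all subcells of a cell, f is tracked within
   2 lambda by a sequence with steps +lambda or -lambda; the (2P)^nu signs are
   stored as the base 3 digits of one real number per cell and are read off one
   by one, each by a few ReLU layers.
     The number of the cell containing x cannot be computed continuously. The
   cells are therefore split into 2^nu classes according to the parities of
   their coordinates; within a class the cells have disjoint neighbourhoods, so
   sums of plateau functions select the data of the cell near x exactly, or
   else certify that x is far from the class. For every class and every subcell
   the network forms the tracked value minus a huge multiple of the distance
   from x to the subcell and of the failure of the certificate. The maximum of
   all these candidates is within 3 lambda of f(x).
     With O(1) units per layer, selecting takes O(N^nu) layers and decoding
   O(P^nu) layers. Taking N^nu ~ P^nu ~ W gives p = 2/nu. If the selection is
   done instead by N^nu ~ W parallel blocks, decoding with P^nu ~ W^(p nu - 1)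
   gives the smaller p. *)

Set Implicit Arguments.
Unset Strict Implicit.
Unset Printing Implicit Defensive.

(** * Digits and bit coding *)

Definition digit (b k t : nat) : nat := ((t %/ b ^ k) %% b)%N.

Lemma digit_lt (b k t : nat) : (0 < b)%N -> (digit b k t < b)%N.
Proof. by move=> b0; rewrite ltn_mod. Qed.

Lemma digitS (b k t : nat) : digit b k.+1 t = digit b k (t %/ b)%N.
Proof. by rewrite /digit expnS divnMA. Qed.

Lemma digit_ex (b n : nat) (a : nat -> nat) :
  (forall k, (k < n)%N -> (a k < b)%N) ->
  exists2 t, (t < b ^ n)%N & forall k, (k < n)%N -> digit b k t = a k.
Proof.
elim: n a => [|n IH] a ab; first by exists 0%N.
have [t tn ta] := IH (fun k => a k.+1) (fun k kn => ab k.+1 kn).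
have a0 := ab 0%N isT.
have b0 : (0 < b)%N by apply: leq_ltn_trans a0.
have tb : ((t * b + a 0) %/ b)%N = t by rewrite divnMDl // divn_small // addn0.
exists (t * b + a 0)%N; first by rewrite expnS; nia.
move=> [|k] kn; last by rewrite digitS tb ta.
by rewrite /digit expn0 divn1 modnMDl modn_small.
Qed.

Lemma digit_inj (b n t t' : nat) : (0 < b)%N -> (t < b ^ n)%N -> (t' < b ^ n)%N ->
  (forall k, (k < n)%N -> digit b k t = digit b k t') -> t = t'.
Proof.
move=> b0; elim: n t t' => [|n IH] t t'.
  by rewrite expn0 !ltnS !leqn0 => /eqP -> /eqP ->.
move=> tn t'n tt'; rewrite (divn_eq t b) (divn_eq t' b).
have := tt' 0%N isT; rewrite /digit !expn0 !divn1 => ->.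
rewrite (IH (t %/ b)%N (t' %/ b)%N) // ?ltn_divLR -?expnSr //.
by move=> k kn; rewrite -!digitS tt'.
Qed.

(* The folded digits of 0, 1, 2, ... in base 2P walk through the whole grid
   {0..P-1}^nu, and no coordinate ever jumps by more than one. *)
Definition fold_digit (P k t : nat) : nat :=
  minn (digit (2 * P) k t) ((2 * P).-1 - digit (2 * P) k t)%N.

Lemma fold_digit_lt (P k t : nat) : (0 < P)%N -> (fold_digit P k t < P)%N.
Proof. rewrite /fold_digit; lia. Qed.

Lemma fold_digit_ex (P n : nat) (a : nat -> nat) :
  (forall k, (k < n)%N -> (a k < P)%N) ->
  exists2 t, (t < (2 * P) ^ n)%N & forall k, (k < n)%N -> fold_digit P k t = a k.
Proof.
move=> aP; have [|t tn ta] := @digit_ex (2 * P) n a.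
  by move=> k /aP; lia.
by exists t => // k kn; rewrite /fold_digit ta //; have := aP k kn; lia.
Qed.

Lemma digit_succ (b k t : nat) : (0 < b)%N ->
  [\/ digit b k t.+1 = digit b k t, digit b k t.+1 = (digit b k t).+1
    | digit b k t.+1 = 0%N /\ digit b k t = b.-1].
Proof.
move=> b0; rewrite /digit.
have : (t.+1 %/ b ^ k = t %/ b ^ k)%N \/ (t.+1 %/ b ^ k = (t %/ b ^ k).+1)%N.
  by rewrite divnS ?expn_gt0 ?b0 //; case: (_ %| _)%N; [right|left].
case=> ->; first by constructor 1.
rewrite modnS; case: ifPn => [/dvdnP[q qE]|_]; last by constructor 2.
constructor 3; split=> //.
case: q qE => [//|q] qE; have -> : (t %/ b ^ k = q * b + b.-1)%N by lia.
by rewrite modnMDl modn_small // ltn_predL.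
Qed.

(** The digits [2 * P - 1] and 0 both fold to 0, so a carry leaves the folded digit unchanged. Any
    other change of a digit is by one, and folding does not enlarge it. *)
Lemma fold_digit_succ (P k t : nat) : (0 < P)%N ->
  (fold_digit P k t.+1 <= (fold_digit P k t).+1)%N /\
  (fold_digit P k t <= (fold_digit P k t.+1).+1)%N.
Proof.
move=> P0; rewrite /fold_digit.
have b0 : (0 < 2 * P)%N by lia.
have := digit_lt k t b0; have := digit_lt k t.+1 b0.
by case: (@digit_succ (2 * P) k t b0) => [->|->|[-> ->]]; lia.
Qed.

(** * Tracking a sequence by signs, and storing the signs in one real number *)

Section Coding.
Variable R : realType.
Implicit Types (u : nat -> R) (lam th : R) (s : seq bool).

Lemma relu_ge0 (t : R) : 0 <= relu t.
Proof. by rewrite /relu le_max lexx orbT. Qed.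

Lemma relu_id (t : R) : 0 <= t -> relu t = t.
Proof. by move=> t0; apply/max_idPl. Qed.

Lemma relu_eq0 (t : R) : t <= 0 -> relu t = 0.
Proof. by move=> t0; apply/max_idPr. Qed.

Lemma reluP (t : R) : (0 <= t /\ relu t = t) \/ (t <= 0 /\ relu t = 0).
Proof.
case: (leP 0 t) => [t0|/ltW t0]; first by left; rewrite relu_id.
by right; rewrite relu_eq0.
Qed.

(** Step [t'] compares with [u t'], so it is [track u lam t.+1] that approximates [u t]. *)
Fixpoint track u lam (t : nat) : R :=
  if t is t'.+1 then
    let v := track u lam t' in v + (if v < u t' then lam else - lam)
  else u 0%N.

Definition track_bit u lam (t : nat) : bool := track u lam t < u t.

(** Each step is [- lam] plus [2 * lam] times its bit, so the value depends on the bits only through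
    their sum; a network need only keep a running count. *)
Lemma trackE u lam t :
  track u lam t = u 0%N + 2 * lam * (\sum_(s < t) (track_bit u lam s)%:R) - lam * t%:R.
Proof.
elim: t => [|t IH]; first by rewrite big_ord0 /= mulr0 mulr0 addr0 subr0.
rewrite /= big_ord_recr /= -/(track_bit u lam t) {1}IH -natr1.
by case: (track_bit _ _ _) => /=; ring.
Qed.

Lemma track_close u lam T : 0 <= lam ->
  (forall t, (t.+1 < T)%N -> `|u t.+1 - u t| <= lam) ->
  forall t, (t < T)%N -> `|track u lam t.+1 - u t| <= 2 * lam.
Proof.
move=> l0 uT t tT.
(* Invariant before the comparison: a step of size [lam] towards [u t] brings an error of at most
   [3 * lam] down to at most [2 * lam], and passing to [u t.+1] adds at most [lam]. *)
suff : `|track u lam t - u t| <= 3 * lam.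
  by rewrite /= !ler_norml => /andP[? ?]; case: ltP => ?; lra.
elim: t tT => [|t IH] tT; first by rewrite /= subrr normr0; lra.
have := IH (ltnW tT); have := uT _ tT.
by rewrite /= !ler_norml => /andP[? ?] /andP[? ?]; case: ltP => ?; lra.
Qed.

Definition encode : seq bool -> R := foldr (fun (b : bool) th => (b%:R + th) / 3) 0.
(** Since only the digits 0 and 1 occur, codes starting with 0 lie in [0, 1/6] and those starting
    with 1 in [1/3, 1/2]. This ramp rises from 0 to 1 across the gap, so it reads the leading digit
    exactly. *)
Definition lead_bit th : R := relu (6 * th - 1) - relu (6 * th - 2).
Definition next_code th : R := relu (3 * th - lead_bit th).

Lemma encode_bound s : 0 <= encode s <= 2^-1.
Proof.
by elim: s => [|b s IH] /=; [lra|case: b; move: IH => /=; lra].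
Qed.

Lemma lead_bit_encode (b : bool) s : lead_bit (encode (b :: s)) = b%:R.
Proof.
have := encode_bound s; rewrite /lead_bit /=.
case: b => /= /andP[h1 h2]; last by rewrite !relu_eq0 //; lra.
by rewrite !relu_id; lra.
Qed.

Lemma next_code_encode (b : bool) s : next_code (encode (b :: s)) = encode s.
Proof.
rewrite /next_code lead_bit_encode /=.
by have := encode_bound s; rewrite -/(encode s) => ?; rewrite relu_id; lra.
Qed.

Lemma lead_bit_bound th : 0 <= lead_bit th <= 1.
Proof.
rewrite /lead_bit.
by case: (reluP (6 * th - 1)) => -[? ->]; case: (reluP (6 * th - 2)) => -[? ->]; lra.
Qed.

Definition decoded th (t : nat) : R := \sum_(s < t) lead_bit (iter s next_code th).

(** Stated for every real [th]: away from the cells of a class, the network decodes a number that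
    need not be a code. *)
Lemma decoded_bound th t : 0 <= decoded th t <= t%:R.
Proof.
apply/andP; split.
  by apply: sumr_ge0 => s _; case/andP: (lead_bit_bound (iter s next_code th)).
have -> : t%:R = \sum_(s < t) 1 :> R by rewrite sumr_const card_ord.
apply: ler_sum => s _; by case/andP: (lead_bit_bound (iter s next_code th)).
Qed.

Lemma decoded_encode (b : nat -> bool) T t : (t <= T)%N ->
  decoded (encode (mkseq b T)) t = \sum_(s < t) (b s)%:R.
Proof.
move=> tT; apply: eq_bigr => -[s /= st] _.
have sT := leq_trans st tT.
suff -> : iter s next_code (encode (mkseq b T)) = encode (drop s (mkseq b T)).
  by rewrite (drop_nth false) ?size_mkseq // lead_bit_encode nth_mkseq.
elim: s sT {st} => [|s IH] sT; first by rewrite drop0.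
by rewrite iterS IH ?(ltnW sT) // (drop_nth false) ?size_mkseq ?(ltnW sT) //
  next_code_encode.
Qed.

End Coding.

(** * Cells, plateaus and candidates *)

Section Boxes.
Variable R : realType.

(** For [c >= 0] this is [c] times the l1 distance from [y] to the unit cube with lower corner
    [l]. *)
Definition box (n : nat) (c : R) (l y : nat -> R) : R :=
  \sum_(k < n) (relu (c * (l k - y k)) + relu (c * (y k - l k - 1))).

Lemma box_ge0 n c l y : 0 <= box n c l y.
Proof. by apply: sumr_ge0 => k _; rewrite addr_ge0 ?relu_ge0. Qed.

Lemma box_eq0 n c l y : 0 <= c ->
  (forall k, (k < n)%N -> l k <= y k <= l k + 1) -> box n c l y = 0.
Proof.
move=> c0 ly; apply: big1 => k _; have /andP[? ?] := ly k (ltn_ord k).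
by rewrite !relu_eq0 ?addr0 // mulr_ge0_le0 //; lra.
Qed.

Lemma box_lt n c l y d k : box n c l y < d -> (k < n)%N ->
  c * (l k - y k) < d /\ c * (y k - l k - 1) < d.
Proof.
move=> bd kn.
have : relu (c * (l k - y k)) + relu (c * (y k - l k - 1)) <= box n c l y.
  rewrite /box (bigD1 (Ordinal kn)) //= lerDl.
  by apply: sumr_ge0 => i _; rewrite addr_ge0 ?relu_ge0.
case: (reluP (c * (l k - y k))) => -[? ->];
by case: (reluP (c * (y k - l k - 1))) => -[? ->]; lra.
Qed.

Lemma floor_cell (n : nat) (y : R) : (0 < n)%N -> 0 <= y <= n%:R ->
  exists2 i, (i < n)%N & i%:R <= y <= i%:R + 1.
Proof.
(* The right end point belongs to the last cell, although truncation would send it one cell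
   further. *)
case: n => // n _ /andP[y0 yn]; case: (leP n%:R y) => ny.
  by exists n => //; rewrite ny natr1.
have /andP[iy yi] := truncn_itv y0.
exists (Num.truncn y); last by rewrite iy natr1 ltW.
by rewrite -(ltr_nat R); apply: le_lt_trans iy _; rewrite (lt_le_trans ny) // ler_nat.
Qed.

End Boxes.

Section Candidates.
Variables (R : realType) (nu N P : nat).
Hypotheses (N0 : (0 < N)%N) (P0 : (0 < P)%N).
Variables (f : 'rV[R]_nu -> R) (m lam : R).
Implicit Types (x y : 'rV[R]_nu).

(** The list is the one that the input layer evaluates to, so [layer_out0] holds by computation;
    indices from [nu] on give 0. *)
Definition point_coord x (k : nat) : R := nth 0 [seq x ord0 i | i <- enum 'I_nu] k.

Lemma point_coordE x (i : 'I_nu) : point_coord x i = x ord0 i.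
Proof.
rewrite /point_coord (nth_map i) ?size_enum_ord //.
by congr (x _ _); apply: val_inj; rewrite /= nth_enum_ord.
Qed.

Lemma point_coord_cube x k : cube x -> 0 <= point_coord x k <= 1.
Proof.
move=> xc; case: (ltnP k nu) => kn; first by rewrite (point_coordE x (Ordinal kn)).
by rewrite /point_coord nth_default ?lexx ?ler01 // size_map size_enum_ord.
Qed.

(* Cells of the coarse grid are numbered by j < N ^ nu through the base N
   digits of j; cells of the same class q < 2 ^ nu agree in the parities of
   all coordinates, so that their neighbourhoods are disjoint. *)
Definition same_class (q j : nat) : bool :=
  [forall k : 'I_nu, digit 2 k q == (digit N k j %% 2)%N].

(** In units of the cell side, the factor 4 turns the thresholds 1 and 2 used below into the
    distances 1/4 and 1/2 from the cell. *)
Definition coarse_box (j : nat) x : R :=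
  box nu 4 (fun k => (digit N k j)%:R) (fun k => N%:R * point_coord x k).

Definition wide (j : nat) x : R := relu (2 - coarse_box j x).
Definition tight (j : nat) x : R := relu (1 - coarse_box j x).

Lemma wide_tight (j : nat) x : 0 <= wide j x - tight j x <= 1.
Proof.
rewrite /wide /tight; case: (reluP (2 - coarse_box j x)) => -[? ->];
by case: (reluP (1 - coarse_box j x)) => -[? ->]; lra.
Qed.

Definition corner (j t : nat) : 'rV[R]_nu :=
  \row_k (((digit N k j)%:R + (fold_digit P k t)%:R / P%:R) / N%:R).

Definition walk_len : nat := (2 * P) ^ nu.
Definition cells : nat := N ^ nu.
(** Subtracting the lower bound [m] makes the samples nonnegative, so they pass through ReLU units
    unchanged. *)
Definition sample (j t : nat) : R := f (corner j t) - m.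
Definition code (j : nat) : R :=
  encode R (mkseq (track_bit (sample j) lam) walk_len).

Definition attribute (e j : nat) : R :=
  if (e < nu)%N then (digit N e j)%:R
  else if e == nu then code j
  else if e == nu.+1 then sample j 0 else 0.

(* The entries e <= nu.+1 are carried by the plateau [wide - tight], which is
   exactly 1 around the cell; the entry nu.+2 is carried by [tight] and certifies
   that the other entries are exact. *)
Definition coef_wide (q e j : nat) : R := if same_class q j then attribute e j else 0.
Definition coef_tight (q e j : nat) : R :=
  if same_class q j then (if e == nu.+2 then 1 else - attribute e j) else 0.

Definition selected (q e : nat) x : R :=
  \sum_(j < cells) (coef_wide q e j * wide j x + coef_tight q e j * tight j x).

Definition fine_box (t : nat) (n : nat -> R) x : R :=
  box nu 1 (fun k => (fold_digit P k t)%:R)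
    (fun k => P%:R * N%:R * point_coord x k - P%:R * n k).

(** The huge multiple used as penalty: it bounds the decoded values with no condition on [x], as
    [raw_value_le] shows, so subtracting it once makes a candidate nonpositive. *)
Definition ceiling : R := \sum_(j < cells) sample j 0 + 2 * lam * walk_len%:R.

Definition candidate (q t : nat) x : R :=
  selected q nu.+1 x + 2 * lam * decoded (selected q nu x) t.+1 - lam * t.+1%:R
  - ceiling * fine_box t (fun e => selected q e x) x
  - ceiling + ceiling * selected q nu.+2 x.

Lemma attribute_coord j k : (k < nu)%N -> attribute k j = (digit N k j)%:R.
Proof. by rewrite /attribute => ->. Qed.

Lemma attribute_code j : attribute nu j = code j.
Proof. by rewrite /attribute ltnn eqxx. Qed.

Lemma attribute_base j : attribute nu.+1 j = sample j 0.
Proof. by rewrite /attribute ltnNge leqnSn (gtn_eqF (ltnSn nu)) eqxx. Qed.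

Hypothesis lam0 : 0 <= lam.
Hypothesis fm : forall x, cube x -> m <= f x.
Hypothesis f_near : forall x y, cube x -> cube y ->
  (forall k, (k < nu)%N -> P%:R * N%:R * `|point_coord x k - point_coord y k| <= 2) ->
  `|f x - f y| <= lam.

Lemma corner_cube j t : cube (corner j t).
Proof.
move=> k; rewrite mxE.
have n0 : 0 < N%:R :> R by rewrite ltr0n.
have p0 : 0 < P%:R :> R by rewrite ltr0n.
rewrite divr_ge0 ?addr_ge0 ?divr_ge0 ?ler0n //= ler_pdivrMr // mul1r.
have : (digit N k j)%:R + 1 <= N%:R :> R by rewrite natr1 ler_nat digit_lt.
apply: le_trans; rewrite lerD2l ler_pdivrMr // mul1r ler_nat.
exact/ltnW/fold_digit_lt.
Qed.

Lemma coord_corner j t k : (k < nu)%N ->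
  P%:R * N%:R * point_coord (corner j t) k = P%:R * (digit N k j)%:R + (fold_digit P k t)%:R.
Proof.
move=> kn; rewrite (point_coordE _ (Ordinal kn)) mxE /=; field.
by rewrite !pnatr_eq0 -!lt0n N0 P0.
Qed.

Lemma sample_ge0 j t : 0 <= sample j t.
Proof. by rewrite subr_ge0 fm //; apply: corner_cube. Qed.

Lemma ceiling_ge0 : 0 <= ceiling.
Proof.
by rewrite addr_ge0 ?mulr_ge0 ?ler0n // sumr_ge0 // => j _; apply: sample_ge0.
Qed.

Lemma code_ge0 j : 0 <= code j.
Proof. by case/andP: (encode_bound R (mkseq (track_bit (sample j) lam) walk_len)). Qed.

Lemma attribute_ge0 e j : 0 <= attribute e j.
Proof.
rewrite /attribute; case: ifP => _; first by rewrite ler0n.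
case: ifP => _; first exact: code_ge0.
by case: ifP => _; rewrite ?sample_ge0.
Qed.

Lemma selected_term_ge0 q e j x :
  0 <= coef_wide q e j * wide j x + coef_tight q e j * tight j x.
Proof.
rewrite /coef_wide /coef_tight; case: ifP => _; last by rewrite !mul0r addr0.
case: ifP => _.
  by rewrite addr_ge0 // mulr_ge0 ?attribute_ge0 ?relu_ge0 //.
rewrite mulNr -mulrBr mulr_ge0 ?attribute_ge0 //.
by case/andP: (wide_tight j x).
Qed.

(** By [fold_digit_succ], consecutive corners of the walk differ by at most one subcell side in each
    coordinate. *)
Lemma sample_step j t : (t.+1 < walk_len)%N -> `|sample j t.+1 - sample j t| <= lam.
Proof.
move=> _; rewrite /sample.
have -> : f (corner j t.+1) - m - (f (corner j t) - m) = f (corner j t.+1) - f (corner j t).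
  by ring.
apply: f_near; try exact: corner_cube.
move=> k kn; have pn0 : 0 <= P%:R * N%:R :> R by rewrite mulr_ge0 ?ler0n.
rewrite -{1}(ger0_norm pn0) -normrM mulrBr !coord_corner //.
have [h1 h2] := fold_digit_succ k t P0.
have {}h1 : (fold_digit P k t.+1)%:R <= (fold_digit P k t)%:R + 1 :> R.
  by rewrite natr1 ler_nat.
have {}h2 : (fold_digit P k t)%:R <= (fold_digit P k t.+1)%:R + 1 :> R.
  by rewrite natr1 ler_nat.
by rewrite ler_norml; apply/andP; split; lra.
Qed.

Lemma value_close j t : (t < walk_len)%N ->
  `|sample j 0 + 2 * lam * decoded (code j) t.+1 - lam * t.+1%:R - sample j t| <= 2 * lam.
Proof.
move=> tT; rewrite decoded_encode // -trackE.
exact: (track_close lam0 (@sample_step j)).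
Qed.

(** Distinct cells with equal parities are at least one cell side apart in some coordinate, but [x]
    would be within 1/4 of one and 1/2 of the other. *)
Lemma same_class_far q j j' x : (j < cells)%N -> (j' < cells)%N ->
  same_class q j -> same_class q j' ->
  coarse_box j x < 1 -> coarse_box j' x < 2 -> j' = j.
Proof.
move=> jc j'c /forallP qj /forallP qj' bj bj'.
apply: (digit_inj N0 j'c jc) => k kn.
have [a1 a2] := box_lt bj kn; have [b1 b2] := box_lt bj' kn.
have := qj (Ordinal kn); have := qj' (Ordinal kn); rewrite /= => /eqP -> /eqP par.
have l1 : (digit N k j)%:R < (digit N k j')%:R + 2 :> R by lra.
have l2 : (digit N k j')%:R < (digit N k j)%:R + 2 :> R by lra.
move: l1 l2; rewrite -!natrD !ltr_nat; lia.
Qed.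

(** By [same_class_far] only the terms of cell [j] survive, and there [wide - tight] equals 1 while
    [tight] is 1 minus the box. *)
Lemma selected_exact q j x e : (j < cells)%N -> same_class q j -> coarse_box j x < 1 ->
  (e < nu.+2)%N ->
  selected q e x = attribute e j /\ selected q nu.+2 x = 1 - coarse_box j x.
Proof.
move=> jc qj bj e2.
have zero i : i != Ordinal jc -> same_class q i -> wide i x = 0 /\ tight i x = 0.
  move=> ij qi; case: (ltP (coarse_box i x) 2) => bi.
    have ij' := same_class_far jc (ltn_ord i) qj qi bj bi.
    by move: ij; rewrite -(inj_eq val_inj) /= ij' eqxx.
  by split; rewrite /wide /tight relu_eq0 //; lra.
have b0 : 0 <= coarse_box j x := box_ge0 _ _ _ _.
have at2 : attribute nu.+2 j = 0 by rewrite /attribute !ifF //; lia.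
split; rewrite /selected (bigD1 (Ordinal jc)) //= big1 ?addr0.
- rewrite /coef_wide /coef_tight qj ifF; last by lia.
  by rewrite /wide /tight !relu_id; [ring|lra|lra].
- move=> i ij; rewrite /coef_wide /coef_tight.
  by case: ifP => qi; [have [-> ->] := zero i ij qi; ring|ring].
- by rewrite /coef_wide /coef_tight qj eqxx at2 /tight relu_id; [ring|lra].
- move=> i ij; rewrite /coef_wide /coef_tight.
  by case: ifP => qi; [have [-> ->] := zero i ij qi; ring|ring].
Qed.

Lemma selected_zero q x :
  (forall j, (j < cells)%N -> same_class q j -> 1 <= coarse_box j x) ->
  selected q nu.+2 x = 0.
Proof.
move=> far; apply: big1 => j _; rewrite /coef_wide /coef_tight.
case: ifP => [qj|_]; last by ring.
rewrite eqxx [tight _ _]relu_eq0; last by have := far j (ltn_ord j) qj; lra.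
by rewrite /attribute !ifF; [ring|lia..].
Qed.

(** Every sample enters with a factor [wide - tight] in [0, 1], and at most [walk_len] bits are
    counted. *)
Lemma raw_value_le q t x : (t < walk_len)%N ->
  selected q nu.+1 x + 2 * lam * decoded (selected q nu x) t.+1 <= ceiling.
Proof.
move=> tT; apply: lerD.
  apply: ler_sum => j _; rewrite /coef_wide /coef_tight.
  case: ifP => _; last by rewrite !mul0r addr0 sample_ge0.
  rewrite ifF; last by lia.
  rewrite attribute_base mulNr -mulrBr ler_piMr ?sample_ge0 //.
  by case/andP: (wide_tight j x).
rewrite ler_wpM2l ?mulr_ge0 //.
case/andP: (decoded_bound (selected q nu x) t.+1) => _ /le_trans; apply.
by rewrite ler_nat.
Qed.

Lemma fine_box_exact t j x n :
  (forall k, (k < nu)%N -> n k = (digit N k j)%:R) ->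
  fine_box t n x = box nu 1 (fun k => (fold_digit P k t)%:R)
    (fun k => P%:R * N%:R * point_coord x k - P%:R * (digit N k j)%:R).
Proof. by move=> nE; apply: eq_bigr => k _; rewrite !nE. Qed.

(** If [x] has no certified cell in the class, or lies at fine distance at least 1 from the subcell,
    a full [ceiling] is lost and the candidate is at most 0. Otherwise the data are exact, and the
    tracking error [2 * lam] and the variation [lam] of [f] add up. *)
Lemma candidate_le q t x : (t < walk_len)%N -> cube x ->
  candidate q t x <= f x - m + 3 * lam.
Proof.
move=> tT xc.
have U0 : 0 <= f x - m + 3 * lam.
  by rewrite addr_ge0 ?mulr_ge0 // subr_ge0 fm.
have C0 := ceiling_ge0.
have raw := raw_value_le q x tT.
have lt0 : 0 <= lam * t.+1%:R by rewrite mulr_ge0 ?ler0n.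
have F0 : 0 <= fine_box t (fun e => selected q e x) x := box_ge0 _ _ _ _.
rewrite /candidate; case: (pselect (exists j, [/\ (j < cells)%N, same_class q j &
  coarse_box j x < 1])) => [[j [jc qj bj]]|none]; last first.
  rewrite selected_zero.
    have := mulr_ge0 C0 F0; lra.
  move=> j jc qj; rewrite leNgt; apply/negP => bj; apply: none; by exists j.
have b0 : 0 <= coarse_box j x := box_ge0 _ _ _ _.
have [_ ->] := selected_exact jc qj bj (ltn0Sn nu.+1).
have Cb := mulr_ge0 C0 b0; have CF := mulr_ge0 C0 F0.
case: (ltP (fine_box t (fun e => selected q e x) x) 1) => F1; last first.
  have := ler_wpM2l C0 F1; lra.
have [-> _] := selected_exact jc qj bj (ltnSn nu.+1).
have [-> _] := selected_exact jc qj bj (leqW (ltnSn nu)).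
rewrite attribute_code attribute_base.
have := value_close j tT; rewrite ler_norml => /andP[_ v2].
suff : `|f x - f (corner j t)| <= lam.
  by rewrite ler_norml /sample in v2 * => /andP[? ?]; lra.
apply: f_near => //; first exact: corner_cube.
move=> k kn; have pn0 : 0 <= P%:R * N%:R :> R by rewrite mulr_ge0 ?ler0n.
rewrite -{1}(ger0_norm pn0) -normrM mulrBr coord_corner //.
rewrite (@fine_box_exact t j) in F1; last first.
  move=> i i_nu; have [-> _] := selected_exact jc qj bj (ltnW (leqW i_nu)).
  by rewrite attribute_coord.
(* Being less than one subcell side away from the subcell means being less than two sides away from
   its corner, the range of [f_near]. *)
have [h1 h2] := box_lt F1 kn.
by rewrite ler_norml; apply/andP; split; lra.
Qed.

(** The witnesses are the class of a cell containing [x] and a time at which the walk visits the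
    subcell containing [x]; for these both penalties vanish. *)
Lemma candidate_ge x : cube x ->
  exists q t, [/\ (q < 2 ^ nu)%N, (t < walk_len)%N &
    f x - m - 3 * lam <= candidate q t x].
Proof.
move=> xc.
have n0 : 0 <= N%:R :> R by rewrite ler0n.
have p0 : 0 <= P%:R :> R by rewrite ler0n.
have cell k : exists i, (i < N)%N && (i%:R <= N%:R * point_coord x k <= i%:R + 1).
  have /andP[x0 x1] := point_coord_cube k xc.
  have [|i iN h] := @floor_cell R N (N%:R * point_coord x k) N0.
    by rewrite mulr_ge0 //= ler_piMr.
  by exists i; rewrite iN.
have /choice[a aP] := cell.
have sub k : exists i, (i < P)%N && (i%:R <= P%:R * (N%:R * point_coord x k - (a k)%:R) <= i%:R + 1).
  have /andP[_ /andP[a1 a2]] := aP k.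
  have [|i iP h] := @floor_cell R P (P%:R * (N%:R * point_coord x k - (a k)%:R)) P0.
    by rewrite mulr_ge0 ?subr_ge0 //= ler_piMr // lerBlDl.
  by exists i; rewrite iP.
have /choice[b bP] := sub.
have [j jc ja] := @digit_ex N nu a (fun k _ => proj1 (andP (aP k))).
have [t tT tb] := @fold_digit_ex P nu b (fun k _ => proj1 (andP (bP k))).
have [|q qc qa] := @digit_ex 2 nu (fun k => a k %% 2)%N.
  by move=> k _; rewrite ltn_mod.
have qj : same_class q j by apply/forallP => k; rewrite qa ?ja.
have cb : coarse_box j x = 0.
  by apply: box_eq0 => // k kn; rewrite ja //; case/andP: (aP k).
have bj : coarse_box j x < 1 by rewrite cb.
exists q, t; split=> //; rewrite /candidate.
have [-> ->] := selected_exact jc qj bj (ltnSn nu.+1).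
have [-> _] := selected_exact jc qj bj (leqW (ltnSn nu)).
rewrite attribute_code attribute_base cb (@fine_box_exact t j); last first.
  move=> i i_nu; have [-> _] := selected_exact jc qj bj (ltnW (leqW i_nu)).
  by rewrite attribute_coord.
rewrite box_eq0 //; last first.
  by move=> k kn; rewrite tb // ja // -mulrA -mulrBr; case/andP: (bP k).
have := value_close j tT; rewrite ler_norml => /andP[v1 _].
suff : `|f x - f (corner j t)| <= lam.
  by rewrite ler_norml /sample in v1 * => /andP[? ?]; lra.
apply: f_near => //; first exact: corner_cube.
move=> k kn; have pn0 : 0 <= P%:R * N%:R :> R by rewrite mulr_ge0 ?ler0n.
rewrite -{1}(ger0_norm pn0) -normrM mulrBr coord_corner // tb // ja //.
have /andP[_ /andP[b1 b2]] := bP k.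
by rewrite ler_norml; apply/andP; split; lra.
Qed.

End Candidates.

(** * Programs for fully connected layers *)

Section Machine.
Variables (R : realType) (X : Type) (D : X -> Prop) (H : nat) (init : X -> nat -> R).
Implicit Types (s : nat -> R) (A : X -> (nat -> R) -> Prop).

Definition layer_step (c : nat -> nat -> R) (b : nat -> R) s (k : nat) : R :=
  if (k < H)%N then relu (\sum_(i < H) c k i * s i + b k) else 0.

Fixpoint run (cs : nat -> nat -> nat -> R) (bs : nat -> nat -> R) (n : nat) s : nat -> R :=
  if n is n'.+1 then layer_step (cs n') (bs n') (run cs bs n' s) else s.

Lemma eq_run cs bs cs' bs' n s : (forall i, (i < n)%N -> cs i = cs' i /\ bs i = bs' i) ->
  run cs bs n s = run cs' bs' n s.
Proof.
elim: n => //= n IH e; rewrite IH; last by move=> i i_n; apply/e/ltnW.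
by have [-> ->] := e n (ltnSn n).
Qed.

(** A postcondition after [n] layers. The weights are chosen before the input [x], so a single
    network serves all inputs. *)
Definition reach (n : nat) A : Prop :=
  exists cs bs, forall x, D x -> A x (run cs bs n (init x)).

Definition affine (e : (nat -> R) -> R) : Prop :=
  exists (c : nat -> R) b, forall s, e s = \sum_(i < H) c i * s i + b.

Lemma affine_cst b : affine (fun=> b).
Proof. by exists (fun=> 0), b => s; rewrite big1 ?add0r // => i _; rewrite mul0r. Qed.

Lemma affine_reg k : (k < H)%N -> affine (fun s => s k).
Proof.
move=> kH; exists (fun i : nat => (i == k)%:R), 0 => s.
rewrite addr0 (bigD1 (Ordinal kH)) //= eqxx mul1r big1 ?addr0 // => i ik.
by rewrite -(inj_eq val_inj) /= in ik; rewrite (negbTE ik) mul0r.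
Qed.

Lemma affine_add e1 e2 : affine e1 -> affine e2 -> affine (fun s => e1 s + e2 s).
Proof.
move=> [c1 [b1 h1]] [c2 [b2 h2]]; exists (fun i => c1 i + c2 i), (b1 + b2) => s.
rewrite h1 h2 addrACA -big_split; congr (_ + _).
by apply: eq_bigr => i _; rewrite mulrDl.
Qed.

Lemma affine_scale a e : affine e -> affine (fun s => a * e s).
Proof.
move=> [c [b h]]; exists (fun i => a * c i), (a * b) => s.
by rewrite h mulrDr mulr_sumr; congr (_ + _); apply: eq_bigr => i _; rewrite mulrA.
Qed.

Lemma affine_opp e : affine e -> affine (fun s => - e s).
Proof.
move=> /(affine_scale (-1)) [c [b h]]; exists c, b => s; by rewrite -h mulN1r.
Qed.

Hypothesis init_ge0 : forall x k, 0 <= init x k.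

Lemma run_ge0 cs bs n x k : 0 <= run cs bs n (init x) k.
Proof.
by case: n => [|n] /=; [exact: init_ge0|rewrite /layer_step; case: ifP; rewrite ?relu_ge0].
Qed.

Lemma reach_weaken n A A' :
  (forall x s, D x -> A x s -> A' x s) -> reach n A -> reach n A'.
Proof. by move=> AA' [cs [bs h]]; exists cs, bs => x xD; apply/AA'/h. Qed.

Lemma reach_layer n A A' (e : nat -> (nat -> R) -> R) :
  (forall k, (k < H)%N -> affine (e k)) ->
  (forall x s s', D x -> (forall j, 0 <= s j) -> A x s ->
     (forall k, (k < H)%N -> s' k = relu (e k s)) -> A' x s') ->
  reach n A -> reach n.+1 A'.
Proof.
move=> eaff step [cs [bs h]].
have aff k : exists cb : (nat -> R) * R, (k < H)%N ->
    forall s, e k s = \sum_(i < H) cb.1 i * s i + cb.2.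
  case: (ltnP k H) => kH; last by exists (fun=> 0, 0).
  by have [c [b cb]] := eaff k kH; exists (c, b).
have /choice[cb cbP] := aff.
pose cs' i := if i == n then fun k => (cb k).1 else cs i.
pose bs' i := if i == n then fun k => (cb k).2 else bs i.
exists cs', bs' => x xD.
have runE : run cs' bs' n (init x) = run cs bs n (init x).
  by apply: eq_run => i i_n; rewrite /cs' /bs' (ltn_eqF i_n).
apply: (step x (run cs bs n (init x))) => //; first exact: run_ge0.
  exact: h.
by move=> k kH; rewrite /= runE /cs' /bs' eqxx /layer_step kH cbP.
Qed.

(** All registers other than [i1] and [i2] are copied, because ReLU fixes the nonnegative values
    they hold. *)
Lemma reach_update n A A' (i1 i2 : nat) e1 e2 :
  affine e1 -> affine e2 -> (i1 < H)%N -> (i2 < H)%N -> i1 != i2 ->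
  (forall x s s', D x -> (forall j, 0 <= s j) -> A x s ->
     s' i1 = relu (e1 s) -> s' i2 = relu (e2 s) ->
     (forall j, (j < H)%N -> j != i1 -> j != i2 -> s' j = s j) -> A' x s') ->
  reach n A -> reach n.+1 A'.
Proof.
move=> a1 a2 i1H i2H i12 step.
apply: (@reach_layer _ _ _ (fun k s => if k == i1 then e1 s else if k == i2 then e2 s else s k)).
  move=> k kH; case: (k == i1) => //; case: (k == i2) => //; exact: affine_reg.
move=> x s s' xD s0 As s'E; apply: (step x s s' xD s0 As).
- by rewrite s'E // eqxx.
- by rewrite s'E // eq_sym (negbTE i12) eqxx.
- by move=> j jH j1 j2; rewrite s'E // (negbTE j1) (negbTE j2) relu_id.
Qed.

Lemma reach_iter (n c : nat) (A : nat -> X -> (nat -> R) -> Prop) (m : nat) :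
  (forall i l, (i < m)%N -> reach l (A i) -> reach (l + c) (A i.+1)) ->
  reach n (A 0%N) -> reach (n + m * c) (A m).
Proof.
elim: m => [|m IH] step A0; first by rewrite addn0.
rewrite mulSn (addnC c) addnA.
by apply: (step m) => //; apply: IH => // i l im; apply/step/ltnW.
Qed.

(** Copying layers fill a program up to a prescribed depth. *)
Lemma reach_idle (n k : nat) (r : nat) (Q : X -> R -> Prop) : (r < H)%N ->
  reach n (fun x s => Q x (s r)) -> reach (n + k) (fun x s => Q x (s r)).
Proof.
move=> rH h; elim: k => [|k IH]; first by rewrite addn0.
rewrite addnS; apply: (@reach_layer _ _ _ (fun k s => s k)) IH => [j|x s s' xD s0 Qs s'E].
  exact: affine_reg.
by rewrite s'E // relu_id.
Qed.

(* Registers: 0..nu-1 hold the point, nu the running maximum, nu+1 the distance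
   to the current box, nu+2 and nu+3 are temporaries; the data selected for a
   class occupy g..g+nu+2: cell coordinates, code, tracked value, certificate. *)
Section Programs.
Variable nu : nat.

Definition scratch (j : nat) : bool := (nu < j < nu + 4)%N.

(** Two layers per coordinate. The same loop serves coarse boxes, with [b] equal to 0, and fine
    boxes, where the lower corner of the cell is read from the registers at [g]. *)
Lemma reach_box n A (g : nat) (l : nat -> R) (a b c : R) :
  (nu + 4 <= g)%N -> (g + nu <= H)%N -> (nu + 4 <= H)%N ->
  (forall x s s', (forall j, (j < H)%N -> ~~ scratch j -> s' j = s j) -> A x s -> A x s') ->
  reach n (fun x s => A x s /\ s nu.+1 = 0) ->
  reach (n + nu * 2) (fun x s => A x s /\
    s nu.+1 = box nu c l (fun k => a * s k - b * s (g + k)%N)).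
Proof.
move=> g4 gH nuH stab h.
pose y s k : R := a * s k - b * s (g + k)%N.
pose term s k : R := relu (c * (l k - y s k)) + relu (c * (y s k - l k - 1)).
have yaff k : (k < nu)%N -> affine (fun s => y s k).
  by move=> kn; apply: affine_add; [|apply: affine_opp]; apply/affine_scale/affine_reg; lia.
apply: (@reach_iter n 2 (fun k x s => A x s /\ s nu.+1 = \sum_(i < k) term s i)).
  move=> k m kn {}h; rewrite addn2.
  (* Layers are handled from last to first: this one adds the two one-sided distances to the sum;
     the next [reach_update] is the earlier layer computing them. *)
  apply: (@reach_update _ (fun x s => [/\ A x s, s nu.+1 = \sum_(i < k) term s i &
    s nu.+2 + s nu.+3 = term s k]) _ nu.+1 nu.+2
    (fun s => s nu.+1 + s nu.+2 + s nu.+3) (fun=> 0)); try lia.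
  - by do 2?apply: affine_add; apply: affine_reg; lia.
  - exact: affine_cst.
  - move=> x s s' _ s0 [As wE tE] w' _ rest; split.
      by apply: stab As => j jH; rewrite /scratch => ns; apply: rest => //; lia.
    rewrite w' relu_id -addrA ?addr_ge0 // tE wE big_ord_recr /=.
    have same i : (i <= k)%N -> term s i = term s' i.
      by move=> ik; rewrite /term /y !rest //; lia.
    by rewrite same //; congr (_ + _); apply: eq_bigr => i _; apply: same; apply: ltnW.
  apply: (@reach_update _ _ _ nu.+2 nu.+3 (fun s => c * (l k - y s k))
    (fun s => c * (y s k - l k - 1))); try lia; last exact: h.
  - apply/affine_scale/affine_add; first exact: affine_cst.
    by apply/affine_opp/yaff.
  - apply/affine_scale/affine_add; last exact: (affine_cst (-1)).
    by apply/affine_add; [exact: yaff|exact: (affine_cst (- l k))].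
  - move=> x s s' _ s0 [As wE] d1 d2 rest.
    have same i : (i <= k)%N -> term s' i = term s i.
      by move=> ik; rewrite /term /y !rest //; lia.
    split.
    + by apply: stab As => j jH; rewrite /scratch => ns; apply: rest => //; lia.
    + rewrite rest; [|lia..]; rewrite wE; apply: eq_bigr => i _.
      by rewrite same // ltnW.
    + by rewrite same // d1 d2.
by apply: reach_weaken h => x s _ [As ->]; rewrite big_ord0.
Qed.

End Programs.
End Machine.

Lemma eq_box (R : realType) (n : nat) (c : R) (l y y' : nat -> R) :
  (forall k, (k < n)%N -> y k = y' k) -> box n c l y = box n c l y'.
Proof. by move=> yy'; apply: eq_bigr => k _; rewrite yy'. Qed.

(** * Decoding the candidates of one class *)

Section Stages.
Variables (R : realType) (nu N P : nat) (f : 'rV[R]_nu -> R) (m lam : R).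
Variables (H : nat) (init : 'rV[R]_nu -> nat -> R) (U : 'rV[R]_nu -> R).
Hypothesis init_ge0 : forall x k, 0 <= init x k.
Hypothesis lam0 : 0 <= lam.

Notation T := (walk_len nu P).
Notation sel := (selected N P f m lam).
Notation cand := (candidate N P f m lam).
Notation reach := (reach (@cube R nu) H init).

Section Decode.
Variables (q g : nat) (E : pred nat) (h : 'rV[R]_nu -> nat -> R).
Variable Acc : 'rV[R]_nu -> R -> Prop.
Hypotheses (gnu : (nu + 4 <= g)%N) (gH : (g + nu + 3 <= H)%N).
Hypothesis E_temp : forall j, (nu <= j < nu + 4)%N -> E j.
Hypothesis E_point : forall k, (k < nu)%N -> ~~ E k.
Hypothesis E_base : forall k, (k < nu + 3)%N -> ~~ E (g + k)%N.
Hypothesis h_point : forall x k, (k < nu)%N -> h x k = point_coord x k.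
Hypothesis h_base : forall x k, (k < nu + 3)%N -> h x (g + k)%N = sel q k x.
Hypothesis Acc_up : forall x a b, a <= b -> Acc x a -> Acc x b.
Hypothesis cand_le : forall x t, cube x -> (t < T)%N -> cand q t x <= U x.

(** Here [t] counts the bits read and [t'] the candidates compared; they differ in the middle of a
    step. [E] marks registers with no guaranteed content, [h] gives the content of the others, and
    [Acc] remembers what the running maximum already dominates. *)
Definition decoding (t t' : nat) (x : 'rV[R]_nu) (s : nat -> R) : Prop :=
  [/\ forall j, (j < H)%N -> ~~ E j -> j != (g + nu)%N -> j != (g + nu.+1)%N -> s j = h x j,
      s (g + nu)%N = iter t (@next_code R) (sel q nu x),
      s (g + nu.+1)%N = sel q nu.+1 x + 2 * lam * decoded (sel q nu x) t &
      [/\ Acc x (s nu), s nu <= U x &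
          forall i, (i < t')%N -> cand q i x <= s nu]].

Lemma decoding_stable t t' x s s' :
  (forall j, (j < H)%N -> ~~ scratch nu j -> s' j = s j) ->
  decoding t t' x s -> decoding t t' x s'.
Proof.
move=> ss' [fr th ba [ac up lo]].
have nus : s' nu = s nu by apply: ss'; rewrite /scratch; lia.
split; rewrite ?nus // ?ss' //; try (rewrite /scratch; lia).
move=> j jH jE j1 j2; rewrite ss' ?fr //.
by apply: contra jE; rewrite /scratch => ?; apply: E_temp; lia.
Qed.

(** After the fine box, four layers split the leading digit into two ramps, update code and tracked
    value, compare, and replace the maximum [v] by [v + relu (c - v)] for the candidate [c]. The bit
    is consumed first because a candidate uses [t.+1] bits. *)
Lemma reach_decode_step n t : (t < T)%N ->
  reach n (fun x s => decoding t t x s /\ s nu.+1 = 0) ->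
  reach (n + (nu * 2 + 4)) (fun x s => decoding t.+1 t.+1 x s /\ s nu.+1 = 0).
Proof.
move=> tT start.
pose F x := fine_box N P t (fun e => sel q e x) x.
have boxed : reach (n + nu * 2) (fun x s => decoding t t x s /\ s nu.+1 = F x).
  apply: reach_weaken (reach_box init_ge0 (g := g) (fun k => (fold_digit P k t)%:R)
    (P%:R * N%:R) P%:R 1 gnu _ _ (@decoding_stable t t) start); try lia.
  move=> x s xc [dec ->]; split=> //; case: dec => fr _ _ _.
  rewrite /F /fine_box; apply: eq_box => k kn; 
  have -> : s k = point_coord x k by rewrite fr ?h_point //; [lia|exact: E_point|lia|lia].
  have k3 : (k < nu + 3)%N by lia.
  by rewrite fr ?h_base //; [lia|exact: E_base|lia|lia].
have bits : reach (n + nu * 2).+1 (fun x s => [/\ decoding t t x s, s nu.+1 = F x &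
    s nu.+2 - s nu.+3 = lead_bit (iter t (@next_code R) (sel q nu x))]).
  apply: (reach_update init_ge0 (i1 := nu.+2) (i2 := nu.+3)
    (e1 := fun s => 6 * s (g + nu)%N - 1) (e2 := fun s => 6 * s (g + nu)%N - 2)) boxed;
    try lia.
  - by apply: affine_add; [apply/affine_scale/affine_reg; lia|exact: affine_cst].
  - by apply: affine_add; [apply/affine_scale/affine_reg; lia|exact: affine_cst].
  - move=> x s s' xc s0 [dec wE] d1 d2 rest; split.
    + apply: decoding_stable dec => j jH; rewrite /scratch => sj; apply: rest => //; lia.
    + by rewrite rest //; lia.
    + by rewrite d1 d2; case: dec => _ -> _ _.
have moved : reach (n + nu * 2).+2 (fun x s => decoding t.+1 t x s /\ s nu.+1 = F x).
  apply: (reach_update init_ge0 (i1 := (g + nu)%N) (i2 := (g + nu.+1)%N)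
    (e1 := fun s => 3 * s (g + nu)%N - (s nu.+2 - s nu.+3))
    (e2 := fun s => s (g + nu.+1)%N + 2 * lam * (s nu.+2 - s nu.+3))) bits; try lia.
  - do ![apply: affine_add|apply: affine_opp|apply: affine_scale|apply: affine_reg]; lia.
  - do ![apply: affine_add|apply: affine_opp|apply: affine_scale|apply: affine_reg]; lia.
  - move=> x s s' xc s0 [[fr th ba acc] wE bE] th' ba' rest.
    have nus : s' nu = s nu by apply: rest; lia.
    split; last by rewrite rest //; lia.
    split; last by rewrite nus.
    + by move=> j jH jE j1 j2; rewrite rest // fr.
    + by rewrite th' bE th.
    + rewrite ba' bE ba [decoded _ t.+1]big_ord_recr /= relu_id; first by rewrite /decoded; ring.
      have b0 : 0 <= lead_bit (iter t (@next_code R) (sel q nu x)).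
        by case/andP: (lead_bit_bound (iter t (@next_code R) (sel q nu x))).
      by rewrite -ba addr_ge0 // mulr_ge0 // mulr_ge0.
pose C := ceiling N P f m lam.
have compared : reach (n + nu * 2).+3 (fun x s => decoding t.+1 t x s /\
    s nu.+2 = relu (cand q t x - s nu)).
  apply: (reach_update init_ge0 (i1 := nu.+2) (i2 := nu.+3)
    (e1 := fun s => s (g + nu.+1)%N - lam * t.+1%:R - C * s nu.+1 - C
                    + C * s (g + nu.+2)%N - s nu) (e2 := fun=> 0)) moved; try lia.
  - by do ![apply: affine_add|apply: affine_opp|apply: affine_scale|apply: affine_reg
      |apply: affine_cst]; lia.
  - exact: affine_cst.
  - move=> x s s' xc s0 [dec wE] d1 _ rest.
    have nus : s' nu = s nu by apply: rest; lia.
    split.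
      apply: decoding_stable dec => j jH; rewrite /scratch => sj; apply: rest => //; lia.
    rewrite d1 nus wE; case: dec => fr _ -> _.
    have n3 : (nu.+2 < nu + 3)%N by lia.
    by rewrite fr ?h_base //; [lia|exact: E_base|lia|lia].
rewrite !addnS addn0.
apply: (reach_update init_ge0 (i1 := nu) (i2 := nu.+1) (e1 := fun s => s nu + s nu.+2)
  (e2 := fun=> 0)) compared; try lia.
- by apply: affine_add; apply: affine_reg; lia.
- exact: affine_cst.
- move=> x s s' xc s0 [[fr th ba [ac up lo]] mE] a' w' rest.
  have {}a' : s' nu = Num.max (s nu) (cand q t x).
    rewrite a' mE relu_id ?addr_ge0 ?relu_ge0 //.
    case: (leP (cand q t x) (s nu)) => ?.
      by rewrite relu_eq0 ?addr0 // subr_le0.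
    by rewrite relu_id ?subr_ge0 ?ltW // addrC subrK.
  split; last by rewrite w' relu_id.
  split.
  + move=> j jH jE j1 j2; rewrite rest ?fr //; apply: contraNneq jE => ->;
    by apply: E_temp; lia.
  + by rewrite rest ?th //; lia.
  + by rewrite rest ?ba //; lia.
  + rewrite a'; split.
    * by apply: Acc_up ac; rewrite le_max lexx.
    * by rewrite ge_max up cand_le.
    * move=> i; rewrite ltnS leq_eqVlt => /orP[/eqP ->|/lo it].
        by rewrite le_max lexx orbT.
      by rewrite le_max it.
Qed.

Lemma reach_decode n :
  reach n (fun x s => [/\ forall j, (j < H)%N -> ~~ E j -> s j = h x j, s nu.+1 = 0,
    Acc x (s nu) & s nu <= U x]) ->
  reach (n + T * (nu * 2 + 4)) (fun x s => [/\
    forall j, (j < H)%N -> ~~ E j -> j != (g + nu)%N -> j != (g + nu.+1)%N -> s j = h x j,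
    s nu.+1 = 0, Acc x (s nu), s nu <= U x &
    forall t, (t < T)%N -> cand q t x <= s nu]).
Proof.
move=> start.
apply: (@reach_weaken _ _ _ _ _ _ (fun x s => decoding T T x s /\ s nu.+1 = 0)).
  by move=> x s _ [[? _ _ [? ? ?]] ?].
apply: (@reach_iter _ _ _ _ _ _ _ (fun t x s => decoding t t x s /\ s nu.+1 = 0)).
  by move=> t l tT; apply: reach_decode_step.
apply: reach_weaken start => x s xc [fr w0 ac up]; split=> //; split=> //.
- by move=> j jH jE _ _; apply: fr.
- by rewrite fr ?h_base //; [lia|lia|apply: E_base; lia].
- rewrite fr ?h_base //; [|lia|lia|apply: E_base; lia].
  by rewrite /decoded big_ord0; ring.
Qed.

End Decode.
End Stages.

(** * The complete programs, with sequential and with parallel selection *)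

Section Assembly.
Variables (R : realType) (nu N P : nat) (f : 'rV[R]_nu -> R) (m lam : R) (H : nat).
Hypotheses (N0 : (0 < N)%N) (P0 : (0 < P)%N) (lam0 : 0 <= lam).
Hypothesis fm : forall x, cube x -> m <= f x.
Hypothesis f_near : forall x y : 'rV[R]_nu, cube x -> cube y ->
  (forall k, (k < nu)%N -> P%:R * N%:R * `|point_coord x k - point_coord y k| <= 2) ->
  `|f x - f y| <= lam.

Notation T := (walk_len nu P).
Notation sel := (selected N P f m lam).
Notation cand := (candidate N P f m lam).

Definition target (x : 'rV[R]_nu) : R := f x - m + 3 * lam.

Lemma target_ge0 x : cube x -> 0 <= target x.
Proof. by move=> xc; rewrite addr_ge0 ?mulr_ge0 // subr_ge0 fm. Qed.

Lemma max_candidate_close x (v : R) : cube x -> v <= target x ->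
  (forall q, (q < 2 ^ nu)%N -> forall t, (t < T)%N -> cand q t x <= v) ->
  `|f x - (v + m)| <= 3 * lam.
Proof.
move=> xc up lo; have [q [t [qn tT c]]] := candidate_ge N0 P0 m lam0 f_near xc.
have := lo q qn t tT; rewrite /target in up.
by rewrite ler_norml => ?; apply/andP; split; lra.
Qed.

Section Sequential.
(** The state after the first hidden layer of the narrow network. *)
Definition seq_init (x : 'rV[R]_nu) (k : nat) : R :=
  if (k < nu)%N then relu (point_coord x k) else 0.

Lemma seq_init_ge0 x k : 0 <= seq_init x k.
Proof. by rewrite /seq_init; case: ifP; rewrite ?relu_ge0. Qed.

Notation reach := (reach (@cube R nu) H seq_init).
Hypothesis H_big : (2 * nu + 7 <= H)%N.

(** Register [nu + 4 + e] accumulates entry [e] over the first [j] cells. For [nu <= r < nu + 4] the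
    value is a default and no claim refers to it. *)
Definition partial_selected (q j : nat) (x : 'rV[R]_nu) (r : nat) : R :=
  if (r < nu)%N then point_coord x r
  else \sum_(i < j) (coef_wide N P f m lam q (r - (nu + 4))%N i * wide N i x
                     + coef_tight N P f m lam q (r - (nu + 4))%N i * tight N i x).

Section Selecting.
Variables (q : nat) (Acc : 'rV[R]_nu -> R -> Prop).

Definition selecting (j : nat) (x : 'rV[R]_nu) (s : nat -> R) : Prop :=
  (forall r, (r < H)%N -> ~~ (nu <= r < nu + 4)%N -> s r = partial_selected q j x r) /\
  Acc x (s nu).

Lemma selecting_stable j x s s' :
  (forall r, (r < H)%N -> ~~ scratch nu r -> s' r = s r) ->
  selecting j x s -> selecting j x s'.
Proof.
move=> ss' [fr ac]; split.
  move=> r rH nr; rewrite ss' ?fr //; move: nr; rewrite /scratch; lia.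
by rewrite ss' //; rewrite /scratch; lia.
Qed.

Lemma reach_select_step n j :
  reach n (fun x s => selecting j x s /\ s nu.+1 = 0) ->
  reach (n + (nu * 2 + 2)) (fun x s => selecting j.+1 x s /\ s nu.+1 = 0).
Proof.
move=> start.
have boxed : reach (n + nu * 2) (fun x s => selecting j x s /\ s nu.+1 = coarse_box N j x).
  apply: reach_weaken (reach_box seq_init_ge0 (g := (nu + 4)%N) (fun k => (digit N k j)%:R)
    N%:R 0 4 (leqnn _) _ _ (@selecting_stable j) start); try lia.
  move=> x s xc [sj ->]; split=> //; case: sj => fr _.
  rewrite /coarse_box; apply: eq_box => k kn.
  by rewrite mul0r subr0 fr /partial_selected ?kn //; lia.
have tests : reach (n + nu * 2).+1 (fun x s => [/\ selecting j x s,
    s nu.+2 = wide N j x & s nu.+3 = tight N j x]).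
  apply: (reach_update seq_init_ge0 (i1 := nu.+2) (i2 := nu.+3)
    (e1 := fun s => 2 - s nu.+1) (e2 := fun s => 1 - s nu.+1)) boxed; try lia.
  - by do ![apply: affine_add|apply: affine_opp|apply: affine_reg|apply: affine_cst]; lia.
  - by do ![apply: affine_add|apply: affine_opp|apply: affine_reg|apply: affine_cst]; lia.
  - move=> x s s' xc s0 [sj wE] d1 d2 rest; rewrite d1 d2 wE; split=> //.
    apply: selecting_stable sj => r rH; rewrite /scratch => sr; apply: rest => //; lia.
rewrite !addnS addn0.
apply: (reach_layer seq_init_ge0 (e := fun r s =>
    if (r <= nu)%N then s r else if (r < nu + 4)%N then 0
    else s r + (coef_wide N P f m lam q (r - (nu + 4))%N j * s nu.+2
                + coef_tight N P f m lam q (r - (nu + 4))%N j * s nu.+3))) tests.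
  move=> r rH; case: (r <= nu)%N; first exact: affine_reg.
  case: (r < nu + 4)%N; first exact: affine_cst.
  by do ![apply: affine_add|apply: affine_scale|apply: affine_reg]; lia.
move=> x s s' xc s0 [[fr ac] d1 d2] s'E; split; last first.
  by rewrite s'E ?ltnn ?ifT ?relu_eq0 //; lia.
split; last by rewrite s'E ?leqnn ?relu_id //; lia.
move=> r rH nr; rewrite s'E //.
case: (ltnP r nu) => rn.
  rewrite (ltnW rn) relu_id // fr // /partial_selected rn //.
rewrite !ifF; [|lia|lia].
(* Partial sums survive ReLU because each cell contributes a nonnegative term, despite the negative
   coefficients of [tight]. *)
rewrite d1 d2 relu_id; last by rewrite addr_ge0 // selected_term_ge0.
by rewrite fr // /partial_selected !ifF ?big_ord_recr //; lia.
Qed.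

Lemma reach_select n :
  reach n (fun x s => (forall k, (k < nu)%N -> s k = point_coord x k) /\ Acc x (s nu)) ->
  reach (n.+1 + cells nu N * (nu * 2 + 2))
    (fun x s => selecting (cells nu N) x s /\ s nu.+1 = 0).
Proof.
move=> start.
apply: (@reach_iter _ _ _ _ _ _ _ (fun j x s => selecting j x s /\ s nu.+1 = 0)).
  by move=> j l _; apply: reach_select_step.
(* One extra layer keeps the point and the running maximum and erases what the previous class
   left. *)
apply: (reach_layer seq_init_ge0 (e := fun r s => if (r <= nu)%N then s r else 0)) start.
  by move=> r rH; case: (r <= nu)%N; [exact: affine_reg|exact: affine_cst].
move=> x s s' xc s0 [pt ac] s'E; split; last first.
  by rewrite s'E ?ltnn ?relu_eq0 //; lia.
split; last by rewrite s'E ?leqnn ?relu_id //; lia.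
move=> r rH nr; rewrite s'E // /partial_selected.
case: (ltnP r nu) => rn; first by rewrite (ltnW rn) relu_id // pt.
by rewrite ifF ?relu_eq0 ?big_ord0 //; lia.
Qed.

End Selecting.

Definition seq_depth : nat :=
  (2 ^ nu * (1 + cells nu N * (nu * 2 + 2) + T * (nu * 2 + 4)))%N.

Lemma sequential_program k : reach (seq_depth + k)
  (fun x s => `|f x - (s nu + m)| <= 3 * lam).
Proof.
apply: (reach_idle seq_init_ge0 k (r := nu) (Q := fun x v => `|f x - (v + m)| <= 3 * lam)).
  by lia.
(* Invariant between classes: the maximum dominates all candidates of the first [q] classes and
   never exceeds the target. *)
pose done (q : nat) x (v : R) := v <= target x /\
  forall q', (q' < q)%N -> forall t, (t < T)%N -> cand q' t x <= v.
apply: (@reach_weaken _ _ _ _ _ _ (fun x s =>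
    (forall k, (k < nu)%N -> s k = point_coord x k) /\ done (2 ^ nu)%N x (s nu))).
  by move=> x s xc [_ [up lo]]; apply: max_candidate_close.
rewrite -[seq_depth]add0n.
apply: (@reach_iter _ _ _ _ _ _ _ (fun q x s =>
    (forall k, (k < nu)%N -> s k = point_coord x k) /\ done q x (s nu))); last first.
  exists (fun _ _ _ => 0), (fun _ _ => 0) => x xc /=; split.
    by move=> i inu; rewrite /seq_init inu relu_id //; case/andP: (point_coord_cube i xc).
  by rewrite /done /seq_init ltnn target_ge0.
move=> q l qn start; rewrite !addnA addn1.
have selq := reach_select q (Acc := done q) start.
have dec : reach (l.+1 + cells nu N * (nu * 2 + 2) + T * (nu * 2 + 4))
  (fun x s => [/\ forall j, (j < H)%N -> ~~ (nu <= j < nu + 4)%N ->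
       j != (nu + 4 + nu)%N -> j != (nu + 4 + nu.+1)%N -> s j = partial_selected q (cells nu N) x j,
    s nu.+1 = 0, (forall q', (q' < q)%N -> forall t, (t < T)%N -> cand q' t x <= s nu),
    s nu <= target x & forall t, (t < T)%N -> cand q t x <= s nu]).
  apply: (reach_decode seq_init_ge0 lam0 (E := fun j => (nu <= j < nu + 4)%N)
    (Acc := fun x v => forall q', (q' < q)%N -> forall t, (t < T)%N -> cand q' t x <= v)) => //.
  - by lia.
  - by move=> i; lia.
  - by move=> i; lia.
  - by move=> x i inu; rewrite /partial_selected inu.
  - move=> x i _; rewrite /partial_selected ifF; last by lia.
    by rewrite (_ : (nu + 4 + i - (nu + 4) = i)%N) //; lia.
  - by move=> x a b ab lo q' q'q t tT; apply: le_trans ab; apply: lo.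
  - by move=> x t xc tT; apply: candidate_le.
  - by apply: reach_weaken selq => x s xc [[fr [up lo]] w0].
apply: reach_weaken dec => x s xc [fr _ lo up loq]; split.
  move=> i inu; rewrite fr /partial_selected ?inu //; lia.
split=> // q'; rewrite ltnS leq_eqVlt => /orP[/eqP ->|] //; exact: lo.
Qed.

End Sequential.

Section Parallel.
Hypothesis H_big : (nu + 4 + 2 ^ nu * (nu + 3) <= H)%N.

(** The data of all classes are present at the start, in consecutive groups of [nu + 3] registers
    behind the working registers. *)
Definition par_value (x : 'rV[R]_nu) (r : nat) : R :=
  if (r < nu)%N then point_coord x r else if (r < nu + 4)%N then 0
  else sel ((r - (nu + 4)) %/ (nu + 3))%N ((r - (nu + 4)) %% (nu + 3))%N x.

Definition par_init (x : 'rV[R]_nu) (r : nat) : R := relu (par_value x r).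

Lemma par_init_ge0 x k : 0 <= par_init x k.
Proof. exact: relu_ge0. Qed.

Lemma par_init_cube x r : cube x -> par_init x r = par_value x r.
Proof.
move=> xc; rewrite /par_init relu_id // /par_value; case: ifP => _.
  by case/andP: (point_coord_cube r xc).
case: ifP => // _; apply: sumr_ge0 => j _; exact: selected_term_ge0.
Qed.

Notation reach := (reach (@cube R nu) H par_init).

Definition par_depth : nat := (2 ^ nu * (T * (nu * 2 + 4)))%N.

Lemma parallel_program k : reach (par_depth + k)
  (fun x s => `|f x - (s nu + m)| <= 3 * lam).
Proof.
apply: (reach_idle par_init_ge0 k (r := nu) (Q := fun x v => `|f x - (v + m)| <= 3 * lam)).
  by lia.
(* Decoding a class overwrites part of its group, so only the groups of classes from [q] on are
   still guaranteed. *)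
pose fresh (q j : nat) := ~~ (nu <= j < nu + 4 + q * (nu + 3))%N.
pose done q (x : 'rV[R]_nu) (s : nat -> R) :=
  [/\ forall j, (j < H)%N -> fresh q j -> s j = par_value x j, s nu.+1 = 0,
      (forall q', (q' < q)%N -> forall t, (t < T)%N -> cand q' t x <= s nu) &
      s nu <= target x].
apply: (@reach_weaken _ _ _ _ _ _ (done (2 ^ nu)%N)).
  by move=> x s xc [_ _ lo up]; apply: max_candidate_close.
rewrite -[par_depth]add0n.
apply: (@reach_iter _ _ _ _ _ _ _ done); last first.
  exists (fun _ _ _ => 0), (fun _ _ => 0) => x xc /=; split => //.
  - by move=> j _ _; apply: par_init_cube.
  - by rewrite par_init_cube // /par_value ifF ?ifT //; lia.
  - rewrite par_init_cube // /par_value ltnn ifT ?target_ge0 //; lia.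
move=> q l qn start.
have qb : (nu + 4 + q * (nu + 3) + nu + 3 <= H)%N.
  by apply: leq_trans H_big; nia.
pose g := (nu + 4 + q * (nu + 3))%N.
have dec : reach (l + T * (nu * 2 + 4))
  (fun x s => [/\ forall j, (j < H)%N -> fresh q j ->
       j != (g + nu)%N -> j != (g + nu.+1)%N -> s j = par_value x j,
    s nu.+1 = 0, (forall q', (q' < q)%N -> forall t, (t < T)%N -> cand q' t x <= s nu),
    s nu <= target x & forall t, (t < T)%N -> cand q t x <= s nu]).
  apply: (reach_decode par_init_ge0 lam0 (E := fun j => (nu <= j < g)%N)
    (Acc := fun x v => forall q', (q' < q)%N -> forall t, (t < T)%N -> cand q' t x <= v)) => //.
  - by rewrite /g; lia.
  - by move=> j; rewrite /g; lia.
  - by move=> j; rewrite /g; lia.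
  - by move=> j; rewrite /g; lia.
  - by move=> x j jn; rewrite /par_value jn.
  - move=> x j j3; rewrite /par_value /g !ifF; [|lia|lia].
    rewrite (_ : (nu + 4 + q * (nu + 3) + j - (nu + 4) = q * (nu + 3) + j)%N); last by lia.
    by rewrite modnMDl modn_small // divnMDl ?divn_small ?addn0 //; lia.
  - by move=> x a b ab lo q' q'q t tT; apply: le_trans ab; apply: lo.
  - by move=> x t xc tT; apply: candidate_le.
apply: reach_weaken dec => x s xc [fr w0 lo up loq]; split => //.
  move=> j jH; rewrite /fresh => nj; apply: fr => //; rewrite /fresh /g; nia.
by move=> q'; rewrite ltnS leq_eqVlt => /orP[/eqP ->|] //; exact: lo.
Qed.

End Parallel.
End Assembly.

(** * Network semantics *)

Section Networks.
Variables (R : realType) (nu : nat).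
Implicit Types (A : arch) (w : weights R) (x : 'rV[R]_nu).

Definition layer_out A w x (j k : nat) : R := nth 0 (nth [::] (layer_vals A w x j) j) k.

Lemma size_layer_vals A w x l : size (layer_vals A w x l) = l.+1.
Proof. by elim: l => //= l IH; rewrite size_rcons IH. Qed.

Lemma nth_layer_vals A w x l j : (j <= l)%N ->
  nth [::] (layer_vals A w x l) j = nth [::] (layer_vals A w x j) j.
Proof.
elim: l => [|l IH]; first by rewrite leqn0 => /eqP ->.
rewrite leq_eqVlt => /orP[/eqP -> //|jl]; rewrite -IH //.
by rewrite [in LHS]/= nth_rcons size_layer_vals jl.
Qed.

Lemma layer_out0 A w x k : layer_out A w x 0 k = point_coord x k.
Proof. by []. Qed.

Lemma layer_outS A w x l k :
  (k < size (nth [::] (hidden_layers A) l))%N ->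
  layer_out A w x l.+1 k =
    relu (unit_pre w l.+1 k (nth [::] (nth [::] (hidden_layers A) l) k) (layer_vals A w x l)).
Proof.
move=> kl; rewrite /layer_out /= nth_rcons size_layer_vals ltnn eqxx.
by rewrite nth_mkseq.
Qed.

Lemma unit_preE A w x l L k srcs : (forall s, s \in srcs -> (s.1 <= l)%N) ->
  unit_pre w L k srcs (layer_vals A w x l) =
    \sum_(i < size srcs) wt w L k i *
      layer_out A w x (nth (0%N, 0%N) srcs i).1 (nth (0%N, 0%N) srcs i).2 + bias w L k.
Proof.
move=> sl; congr (_ + _); apply: eq_bigr => i _.
by rewrite /layer_out nth_layer_vals // sl // mem_nth.
Qed.

Lemma unit_pre_layer A w x l L k j n : (j <= l)%N ->
  unit_pre w L k [seq (j, i) | i <- iota 0 n] (layer_vals A w x l) =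
    \sum_(i < n) wt w L k i * layer_out A w x j i + bias w L k.
Proof.
move=> jl; rewrite unit_preE; last by move=> s /mapP[i _ ->].
have sz : size [seq (j, i) | i <- iota 0 n] = n by rewrite size_map size_iota.
rewrite -(big_mkord xpredT (fun i => wt w L k i *
  layer_out A w x (nth (0%N, 0%N) [seq (j, i) | i <- iota 0 n] i).1
   (nth (0%N, 0%N) [seq (j, i) | i <- iota 0 n] i).2)) sz big_mkord.
congr (_ + _); apply: eq_bigr => i _.
by rewrite (nth_map 0%N) ?size_iota // nth_iota // add0n.
Qed.

(** Identifies a fully connected stretch of a network with [run]; the offset [j0] lets it serve both
    kinds of architecture. *)
Lemma fc_tail A w x (H j0 n : nat) cs bs (s : nat -> R) :
  (forall i, (i < n)%N -> nth [::] (hidden_layers A) (j0 + i)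
     = nseq H [seq ((j0 + i)%N, k) | k <- iota 0 H]) ->
  (forall i, (i < n)%N -> wt w (j0 + i).+1 = cs i /\ bias w (j0 + i).+1 = bs i) ->
  (forall k, (k < H)%N -> layer_out A w x j0 k = s k) ->
  forall k, (k < H)%N -> layer_out A w x (j0 + n) k = run H cs bs n s k.
Proof.
move=> hid wts base; elim: n hid wts => [|n IH] hid wts k kH; first by rewrite addn0 base.
rewrite addnS layer_outS ?hid ?size_nseq // nth_nseq kH unit_pre_layer //.
rewrite /= /layer_step kH; have [-> ->] := wts n (ltnSn n).
congr (relu (_ + _)); apply: eq_bigr => i _; rewrite IH // => i' i'n.
  exact/hid/ltnW.
exact/wts/ltnW.
Qed.

Lemma fc_net (H L r : nat) (m : R) (Q : 'rV[R]_nu -> R -> Prop) :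
  (1 <= L)%N -> (nu <= H)%N -> (r < H)%N ->
  reach (@cube R nu) H (@seq_init R nu) L.-1 (fun x s => Q x (s r + m)) ->
  exists w, forall x, cube x -> Q x (net_fun nu (fc_arch nu H L) w x).
Proof.
move=> L1 nuH rH [cs [bs ok]].
(* Layer 1 loads the point, layers 2 to [L] carry the [L.-1] program steps, and the output unit
   returns register [r] plus [m]. *)
pose w := Weights
  (fun l => if l == 1%N then fun k i => ((k < nu)%N && (i == k))%:R
            else if l == L.+1 then fun _ i => (i == r)%:R else cs (l - 2)%N)
  (fun l => if l == 1%N then fun=> 0 else if l == L.+1 then fun=> m else bs (l - 2)%N).
exists w => x xc.
have first_layer k : (k < H)%N ->
    layer_out (fc_arch nu H L) w x 1 k = seq_init x k.
  move=> kH; have hid : nth [::] (hidden_layers (fc_arch nu H L)) 0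
      = nseq H [seq (0%N, k) | k <- iota 0 nu] by rewrite /= nth_mkseq.
  rewrite layer_outS hid ?size_nseq // nth_nseq kH unit_pre_layer // /= addr0 /seq_init; case: ltnP => kn; last first.
    by rewrite big1 ?relu_eq0 // => i _; rewrite mul0r.
  rewrite (bigD1 (Ordinal kn)) //= eqxx mul1r big1 ?addr0 // => i ik.
  by rewrite -(inj_eq val_inj) /= in ik; rewrite (negbTE ik) mul0r.
have outL k : (k < H)%N -> layer_out (fc_arch nu H L) w x L k
    = run H cs bs L.-1 (seq_init x) k.
  move=> kH; have -> : layer_out (fc_arch nu H L) w x L k
      = layer_out (fc_arch nu H L) w x (1 + L.-1) k by rewrite add1n prednK.
  apply: fc_tail => // i iL.
    by rewrite /fc_arch /= nth_mkseq //; lia.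
  rewrite /w /= !ifF; [|lia..].
  by rewrite (_ : ((1 + i).+1 - 2 = i)%N) //; lia.
rewrite /net_fun {2}/depth size_mkseq unit_pre_layer //.
rewrite /depth size_mkseq /= eqxx.
rewrite !ifF; [|lia..].
rewrite (bigD1 (Ordinal rH)) //= eqxx mul1r big1 ?addr0; last first.
  move=> i ik; rewrite -(inj_eq val_inj) /= in ik.
  by rewrite (negbTE ik) mul0r.
by rewrite outL //; apply: ok.
Qed.

End Networks.

(** * The stacked architecture: layers, well-formedness and size *)

Section UniformFlatten.
Variables (T : Type) (F : nat -> seq T) (s : nat).
Hypothesis sF : forall c, size (F c) = s.

Lemma size_flatten_iota (c0 m : nat) : size (flatten [seq F c | c <- iota c0 m]) = (m * s)%N.
Proof. by elim: m c0 => //= m IH c0; rewrite size_cat sF IH mulSn. Qed.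

Lemma nth_flatten_iota (x0 : T) (m c u : nat) : (c < m)%N -> (u < s)%N ->
  nth x0 (flatten [seq F c | c <- iota 0 m]) (c * s + u) = nth x0 (F c) u.
Proof.
rewrite -[F c]/(F (0 + c)%N); elim: m c 0%N => //= m IH [|c] c0 cm us.
  by rewrite nth_cat sF mul0n us addn0.
rewrite nth_cat sF ifF; last by rewrite mulSn; lia.
rewrite (_ : (c.+1 * s + u - s = c * s + u)%N); last by rewrite mulSn; lia.
by rewrite IH // addSnnS.
Qed.

End UniformFlatten.

(* Each block evaluates one cell of the coarse grid: the first layer holds the
   2 nu one-sided distances (lower sides first), the second the two outputs
   [wide] and [tight]. *)
Definition cell_block (nu : nat) : block :=
  [:: [seq [:: (0%N, (k %% nu)%N)] | k <- iota 0 (nu * 2)];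
      nseq 2 [seq (1%N, k) | k <- iota 0 (nu * 2)]].

(** The narrow part also reads the network input, since the fine boxes need the point itself. *)
Definition glue_srcs (nu m : nat) : seq src :=
  [seq (0%N, k) | k <- iota 0 nu] ++ [seq (2%N, k) | k <- iota 0 (m * 2)].

Definition cell_stack (nu m H L : nat) : arch :=
  stack_arch (cell_block nu) m H L (nseq H (glue_srcs nu m)).

Section CellStack.
Variables (nu m H L : nat).
Hypotheses (nu0 : (0 < nu)%N) (L1 : (1 <= L)%N).
Notation A := (cell_stack nu m H L).

Lemma cell_stack_layer0 : nth [::] (hidden_layers A) 0 =
  flatten [seq [seq [:: (0%N, (k %% nu)%N)] | k <- iota 0 (nu * 2)] | c <- iota 0 m].
Proof.
rewrite [LHS]/=; congr flatten.
by apply: eq_map => c; rewrite -map_comp; apply: eq_map.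
Qed.

Lemma cell_stack_layer1 : nth [::] (hidden_layers A) 1 =
  flatten [seq nseq 2 [seq (1%N, k + c * (nu * 2))%N | k <- iota 0 (nu * 2)] | c <- iota 0 m].
Proof.
rewrite [LHS]/=; congr flatten.
apply: eq_map => c; rewrite -map_comp.
suff -> : [seq (shift_src (cell_block nu) c \o [eta pair 1%N]) i | i <- iota 0 (nu * 2)]
   = [seq (1%N, (k + c * (nu * 2))%N) | k <- iota 0 (nu * 2)] by [].
by apply: eq_map => k; rewrite /shift_src /= size_map size_iota.
Qed.

Lemma cell_stack_layer2 : nth [::] (hidden_layers A) 2 = nseq H (glue_srcs nu m).
Proof. by []. Qed.

Lemma cell_stack_layer_fc i : (i < L.-1)%N -> nth [::] (hidden_layers A) (3 + i) =
  nseq H [seq ((3 + i)%N, k) | k <- iota 0 H].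
Proof. by move=> iL; rewrite /= nth_mkseq. Qed.

Lemma cell_stack_depth : depth A = L.+2.
Proof. by rewrite /depth /= size_mkseq prednK. Qed.

Lemma cell_stack_size j : (j <= L.+2)%N -> layer_size nu A j =
  if j == 0%N then nu else if j == 1%N then (m * (nu * 2))%N
  else if j == 2%N then (m * 2)%N else H.
Proof.
rewrite /layer_size; case: j => [|[|[|j]]] //= jL.
- rewrite -[X in size X]/(nth [::] (hidden_layers A) 0) cell_stack_layer0.
  by rewrite (size_flatten_iota (s := (nu * 2)%N)) // => c; rewrite size_map size_iota.
- rewrite -[X in size X]/(nth [::] (hidden_layers A) 1) cell_stack_layer1.
  by rewrite (size_flatten_iota (s := 2)).
- case: j jL => [|j] jL /=; first by rewrite size_nseq.
  by rewrite nth_mkseq ?size_nseq //; lia.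
Qed.

Lemma cell_stack_wf : wf_arch nu A.
Proof.
have inj j : injective (fun k : nat => (j, k) : src) by move=> a b [].
have uniq_layer j n : uniq [seq (j, k) : src | k <- iota 0 n].
  by rewrite map_inj_uniq ?iota_uniq.
rewrite /wf_arch cell_stack_depth; split; last split.
- move=> [|[|[|l]]] lL u.
  + rewrite cell_stack_layer0 => /flatten_mapP[c _ /mapP[k _ ->]]; split=> // s.
    by rewrite inE => /eqP ->; rewrite cell_stack_size //= ltn_mod.
  + rewrite cell_stack_layer1 => /flatten_mapP[c]; rewrite mem_iota => /= cm.
    rewrite !inE orbb => /eqP ->; split.
      by rewrite map_inj_uniq ?iota_uniq // => a b [] /addIn.
    move=> s /mapP[k]; rewrite mem_iota => /= kn ->; rewrite cell_stack_size //=; split=> //; nia.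
  + rewrite cell_stack_layer2 mem_nseq => /andP[_ /eqP ->]; split.
      rewrite cat_uniq !uniq_layer andbT /=; apply/hasPn => s /mapP[k _ ->].
      by apply/mapP => -[].
    move=> s; rewrite mem_cat => /orP[] /mapP[k]; rewrite mem_iota => /= kn ->;
      by rewrite cell_stack_size //=.
  + rewrite -[l.+3]/(3 + l)%N cell_stack_layer_fc; last by lia.
    rewrite mem_nseq => /andP[_ /eqP ->]; split; first exact: uniq_layer.
    move=> s /mapP[k]; rewrite mem_iota => /= kn ->.
    by rewrite cell_stack_size //=; lia.
- exact: uniq_layer.
- move=> s /mapP[k]; rewrite mem_iota => /= kn ->; rewrite cell_stack_size //=.
  by rewrite add2n /=; case: (L) L1.
Qed.

(** The count is affine in the number [m] of blocks, so [m] can be tuned to a given total up to the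
    cost of one block. *)
Lemma cell_stack_weights : num_weights A =
  (m * (nu * 2 * 2 + (nu * 2).+1 * 2 + 2 * H) + (nu.+1 * H + L.-1 * (H * H.+1) + H.+1))%N.
Proof.
have sumn_const T (F : T -> nat) n (s : seq T) : (forall u, F u = n) -> sumn (map F s) = (size s * n)%N.
  by move=> Fn; elim: s => //= a s ->; rewrite Fn mulSn.
have hidE : hidden_layers A = [:: nth [::] (hidden_layers A) 0, nth [::] (hidden_layers A) 1,
    nseq H (glue_srcs nu m) & mkseq (fun l => nseq H [seq ((2 + l.+1)%N, k) | k <- iota 0 H]) L.-1].
  by [].
rewrite /num_weights {1}hidE cell_stack_layer0 cell_stack_layer1 /=.
rewrite !size_map size_iota.
have sum_flat (G : nat -> seq (seq src)) K :
    (forall c, sumn [seq (size u).+1 | u <- G c] = K) ->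
    sumn [seq (size u).+1 | u <- flatten [seq G c | c <- iota 0 m]] = (m * K)%N.
  by move=> GK; elim: (m) 0%N => //= n IH c; rewrite map_cat sumn_cat IH GK mulSn.
rewrite (sum_flat _ (nu * 2 * 2)%N); last first.
  by move=> c; rewrite -map_comp (sumn_const _ _ 2) // size_iota.
rewrite (sum_flat _ ((nu * 2).+1 * 2)%N); last first.
  by move=> c; rewrite /= size_map size_iota; lia.
have -> : sumn [seq (size u).+1 | u <- nseq H (glue_srcs nu m)] = (H * (nu + m * 2).+1)%N.
  rewrite map_nseq sumn_nseq size_cat !size_map !size_iota; lia.
have -> : sumn [seq sumn [seq (size u).+1 | u <- layer]
    | layer <- mkseq (fun l => nseq H [seq ((2 + l.+1)%N, k) | k <- iota 0 H]) L.-1]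
    = (L.-1 * (H * H.+1))%N.
  rewrite /mkseq -map_comp (sumn_const _ _ (H * H.+1)%N) ?size_iota // => l /=.
  by rewrite map_nseq sumn_nseq size_map size_iota mulnC.
lia.
Qed.

End CellStack.

Lemma sum_pairs (R : realType) (n : nat) (G : nat -> R) :
  \sum_(i < n * 2) G i = \sum_(c < n) (G (c * 2)%N + G (c * 2).+1).
Proof.
elim: n => [|n IH]; first by rewrite !big_ord0.
by rewrite mulSn add2n !big_ord_recr /= IH addrA.
Qed.

(** * Weights of the stacked network and the values they produce *)

Section StackNet.
Variables (R : realType) (nu N P : nat) (f : 'rV[R]_nu -> R) (m lam : R).
Variables (b H L : nat) (cs : nat -> nat -> nat -> R) (bs : nat -> nat -> R).
Hypotheses (nu0 : (0 < nu)%N) (L1 : (1 <= L)%N) (nuH : (nu < H)%N).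
Hypothesis room : (cells nu N <= b)%N.
Notation A := (cell_stack nu b H L).

Definition side_wt (k i : nat) : R :=
  if (k %% (nu * 2) < nu)%N then - (4 * N%:R) else 4 * N%:R.
Definition side_bias (k : nat) : R :=
  let c := (k %/ (nu * 2))%N in let u := (k %% (nu * 2))%N in
  if (u < nu)%N then 4 * (digit N u c)%:R else - (4 * (digit N (u - nu) c)%:R + 4).

(** Rows below [nu] load the point and the next four are 0. Any other row holds the coefficients of
    one entry of one class, alternating between the two outputs of each block; blocks numbered
    [cells nu N] or more get weight 0. *)
Definition glue_wt (k i : nat) : R :=
  if (k < nu)%N then (i == k)%:R
  else if (i < nu)%N || (k < nu + 4)%N then 0
  else if ((i - nu)./2 < cells nu N)%N then
    (if odd (i - nu) then coef_tight else coef_wide) R nu N P f m lam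
      ((k - (nu + 4)) %/ (nu + 3))%N ((k - (nu + 4)) %% (nu + 3))%N (i - nu)./2
  else 0.

Definition stack_weights : weights R := Weights
  (fun l => if l == 1%N then side_wt else if l == 2%N then fun _ _ => -1
            else if l == 3%N then glue_wt
            else if l == L.+3 then fun _ i => (i == nu)%:R else cs (l - 4)%N)
  (fun l => if l == 1%N then side_bias else if l == 2%N then fun k => if odd k then 1 else 2
            else if l == 3%N then fun=> 0
            else if l == L.+3 then fun=> m else bs (l - 4)%N).
Notation out := (layer_out A stack_weights).
Implicit Type x : 'rV[R]_nu.

Lemma stack_layer1 x c u : (c < b)%N -> (u < nu * 2)%N ->
  out x 1 (c * (nu * 2) + u) =
  if (u < nu)%N then relu (4 * ((digit N u c)%:R - N%:R * point_coord x u))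
  else relu (4 * (N%:R * point_coord x (u - nu) - (digit N (u - nu) c)%:R - 1)).
Proof.
move=> cb un.
have F_size (c' : nat) : size [seq [:: (0%N, (k %% nu)%N)] | k <- iota 0 (nu * 2)] = (nu * 2)%N.
  by rewrite size_map size_iota.
rewrite layer_outS cell_stack_layer0.
  rewrite (nth_flatten_iota F_size) // (nth_map 0%N) ?size_iota // nth_iota // add0n.
  rewrite unit_preE; last by move=> s; rewrite inE => /eqP ->.
  rewrite big_ord1 /= layer_out0 /side_wt /side_bias modnMDl modn_small //.
  rewrite divnMDl ?muln_gt0 ?nu0 // divn_small // addn0.
  case: ltnP => unu; congr relu; first by rewrite modn_small //; ring.
  by rewrite -[in (u %% nu)%N](subnK unu) modnDr modn_small; [ring|lia].
rewrite (size_flatten_iota F_size); nia.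
Qed.

Lemma stack_layer2 x c (e : bool) : (c < b)%N ->
  out x 2 (c * 2 + e) = if e then tight N c x else wide N c x.
Proof.
move=> cb.
pose F c := nseq 2 [seq (1%N, k + c * (nu * 2))%N | k <- iota 0 (nu * 2)].
have F_size c' : size (F c') = 2%N by [].
have e2 : (e < 2)%N by case: e.
rewrite layer_outS cell_stack_layer1; last by rewrite (size_flatten_iota F_size); nia.
rewrite (nth_flatten_iota F_size) // nth_nseq e2.
have sz : size [seq (1%N, (k + c * (nu * 2))%N) | k <- iota 0 (nu * 2)] = (nu * 2)%N.
  by rewrite size_map size_iota.
rewrite unit_preE; last by move=> s /mapP[k _ ->].
rewrite -(big_mkord xpredT (fun i => wt stack_weights 2 (c * 2 + e) i *
  out x (nth (0%N, 0%N) [seq (1%N, (k + c * (nu * 2))%N) | k <- iota 0 (nu * 2)] i).1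
   (nth (0%N, 0%N) [seq (1%N, (k + c * (nu * 2))%N) | k <- iota 0 (nu * 2)] i).2)) sz big_mkord.
have -> : \sum_(i < nu * 2) (wt stack_weights 2 (c * 2 + e) i *
  out x (nth (0%N, 0%N) [seq (1%N, (k + c * (nu * 2))%N) | k <- iota 0 (nu * 2)] i).1
   (nth (0%N, 0%N) [seq (1%N, (k + c * (nu * 2))%N) | k <- iota 0 (nu * 2)] i).2)
  = - coarse_box N c x.
  (* The lower and upper sides of the cell form two halves of the block's first layer and are paired
     coordinate by coordinate. *)
  transitivity (- \sum_(i < nu + nu) out x 1 (c * (nu * 2) + i)).
    rewrite -sumrN muln2 -addnn; apply: eq_bigr => i _.
    have i2 : (i < nu * 2)%N by rewrite muln2 -addnn.
    rewrite (nth_map 0%N) ?size_iota //.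
    by rewrite nth_iota // add0n [wt _ _ _ _]/= mulN1r (addnC (i : nat)).
  congr (- _); rewrite big_split_ord /= -big_split; apply: eq_bigr => i _ /=.
  have := ltn_ord i => i_nu.
  rewrite !stack_layer1 ?i_nu //; [|lia|lia].
  by rewrite ifF ?addKn //; lia.
by rewrite /= oddD oddM andbF /= oddb addrC; case: e {e2}.
Qed.

Lemma stack_layer3 x k : (k < H)%N -> out x 3 k = par_init N P f m lam x k.
Proof.
move=> kH; rewrite layer_outS cell_stack_layer2 ?size_nseq // nth_nseq kH.
rewrite unit_preE; last by move=> s; rewrite mem_cat => /orP[] /mapP[i _ ->].
have sz : size (glue_srcs nu b) = (nu + b * 2)%N by rewrite size_cat !size_map !size_iota.
rewrite -(big_mkord xpredT (fun i => wt stack_weights 3 k i *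
  out x (nth (0%N, 0%N) (glue_srcs nu b) i).1 (nth (0%N, 0%N) (glue_srcs nu b) i).2)) sz big_mkord.
rewrite /par_init [wt _ _]/= [bias _ _ _]/= addr0; congr relu.
transitivity (\sum_(i < nu) glue_wt k i * point_coord x i +
  \sum_(i < b * 2) glue_wt k (nu + i) * out x 2 i).
  rewrite big_split_ord; congr (_ + _); apply: eq_bigr => i _ /=.
    rewrite nth_cat size_map size_iota ltn_ord (nth_map 0%N) ?size_iota //.
    by rewrite nth_iota // add0n.
  rewrite nth_cat size_map size_iota ifF; last by lia.
  by rewrite (nth_map 0%N) ?addKn ?size_iota // nth_iota // add0n.
rewrite /par_value /glue_wt; case: (ltnP k nu) => kn.
  rewrite (bigD1 (Ordinal kn)) //= eqxx mul1r big1 ?addr0.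
    rewrite big1 ?addr0 // => i _.
    by rewrite (_ : (nu + i == k)%N = false) ?mul0r //; lia.
  by move=> i ik; rewrite -(inj_eq val_inj) /= in ik; rewrite (negbTE ik) mul0r.
rewrite big1 ?add0r; last by move=> i _; rewrite ltn_ord mul0r.
case: (ltnP k (nu + 4)) => k4; first by rewrite big1 // => i _; rewrite orbT mul0r.
rewrite -[LHS]/(\sum_(i < b * 2) (fun i => (if (nu + i < nu)%N || false then 0
  else if ((nu + i - nu)./2 < cells nu N)%N then
    (if odd (nu + i - nu) then coef_tight else coef_wide) R nu N P f m lam
      ((k - (nu + 4)) %/ (nu + 3))%N ((k - (nu + 4)) %% (nu + 3))%N (nu + i - nu)./2
  else 0) * out x 2 i) i) sum_pairs /selected (big_ord_widen b (fun j =>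
   coef_wide N P f m lam ((k - (nu + 4)) %/ (nu + 3))%N ((k - (nu + 4)) %% (nu + 3))%N j * wide N j x
   + coef_tight N P f m lam ((k - (nu + 4)) %/ (nu + 3))%N ((k - (nu + 4)) %% (nu + 3))%N j * tight N j x)) //.
rewrite [RHS]big_mkcond; apply: eq_bigr => c _.
have /= o0 := @stack_layer2 x c false (ltn_ord c).
have /= o1 := @stack_layer2 x c true (ltn_ord c).
rewrite addn0 in o0; rewrite addn1 in o1; rewrite o0 o1.
have lt_nu a : (nu + a < nu)%N = false by lia.
rewrite !lt_nu !addKn /= oddM andbF /= muln2 uphalf_double doubleK.
by case: ifP => // _; rewrite !mul0r addr0.
Qed.

Lemma stack_net (Q : 'rV[R]_nu -> R -> Prop) :
  (forall x, cube x -> Q x (run H cs bs L.-1 (par_init N P f m lam x) nu + m)) ->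
  forall x, cube x -> Q x (net_fun nu A stack_weights x).
Proof.
move=> ok x xc.
have outL k : (k < H)%N -> out x L.+2 k = run H cs bs L.-1 (par_init N P f m lam x) k.
  move=> kH; have -> : out x L.+2 k = out x (3 + L.-1) k.
    by congr layer_out; lia.
  apply: fc_tail => // [i iL|i iL|i]; first exact: cell_stack_layer_fc.
    rewrite /stack_weights /= !ifF; [|lia..].
    by rewrite (_ : ((3 + i).+1 - 4 = i)%N) //; lia.
  exact: stack_layer3.
rewrite /net_fun {2}cell_stack_depth // unit_pre_layer ?cell_stack_depth ?add2n //.
have wL : wt stack_weights L.+3 = fun _ i => (i == nu)%:R.
  by rewrite /= eqxx ifF //; lia.
have bL : bias stack_weights L.+3 = fun=> m by rewrite /= eqxx ifF //; lia.
rewrite wL bL.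
rewrite (bigD1 (Ordinal nuH)) //= eqxx mul1r big1 ?addr0; last first.
  move=> i ik; rewrite -(inj_eq val_inj) /= in ik.
  by rewrite (negbTE ik) mul0r.
by rewrite outL //; apply: ok.
Qed.

End StackNet.

(** * Modulus of continuity *)

Section Modulus.
Variables (R : realType) (nu : nat) (f : 'rV[R]_nu -> R).
Hypothesis f_cont : {within @cube R nu, continuous f}.

Lemma cube_compact : compact (@cube R nu).
Proof.
rewrite (_ : @cube R nu = [set v | forall i, `[0, 1]%classic (v ord0 i)]); last first.
  by apply/seteqP; split=> v /= h i; have := h i; rewrite in_itv.
apply: (@rV_compact _ nu (fun=> `[0 : R, 1]%classic)) => _; exact: segment_compact.
Qed.

(** Boundedness is what makes the supremum in [modulus] an upper bound and not a default value. *)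
Lemma continuous_cube_bounded : exists b : R, forall x, cube x -> `|f x| <= b.
Proof.
have := compact_bounded (continuous_compact f_cont cube_compact).
move=> [b [_ h]]; exists (b + 1) => x xc.
by apply: (h (b + 1)); [rewrite ltrDl|exists x].
Qed.

Lemma modulus_ge (r : R) x y : cube x -> cube y -> eucl_dist x y <= r ->
  `|f x - f y| <= modulus f r.
Proof.
move=> xc yc xyr; have [b bf] := continuous_cube_bounded.
apply: ub_le_sup; last by exists x, y.
exists (b + b) => _ [u [v [uc [vc [_ ->]]]]].
by apply: le_trans (ler_normB _ _) _; rewrite lerD ?bf.
Qed.

(** The crude factor [nu] replaces its square root; this only affects constants. *)
Lemma eucl_dist_le (d : R) (x y : 'rV[R]_nu) : 0 <= d ->
  (forall i, `|x ord0 i - y ord0 i| <= d) -> eucl_dist x y <= nu%:R * d.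
Proof.
move=> d0 xyd; have nd0 : 0 <= nu%:R * d by rewrite mulr_ge0.
rewrite /eucl_dist -[leRHS]ger0_norm // -sqrtr_sqr ler_wsqrtr //.
apply: (@le_trans _ _ (\sum_(i < nu) d ^+ 2)).
  apply: ler_sum => i _; rewrite -real_normK ?num_real //.
  by rewrite lerXn2r ?nnegrE.
rewrite sumr_const card_ord -[leLHS]mulr_natl exprMn ler_wpM2r ?exprn_ge0 //.
by rewrite -natrX ler_nat; case: (nu) => // n; rewrite -{1}[n.+1]expn1 leq_pexp2l.
Qed.

Lemma modulus_ge0 (r : R) : 0 <= r -> 0 <= modulus f r.
Proof.
move=> r0; have c0 : cube (0 : 'rV[R]_nu) by move=> i; rewrite mxE lexx ler01.
apply: le_trans (modulus_ge c0 c0 _); first by [].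
by rewrite /eucl_dist big1 ?sqrtr0 // => i _; rewrite subrr expr0n.
Qed.

End Modulus.

(** * From programs to approximation bounds *)

Section Approximation.
Variables (R : realType) (nu : nat).
Hypothesis nu0 : (0 < nu)%N.
Implicit Type f : 'rV[R]_nu -> R.

Lemma near_modulus f (N P : nat) (r : R) : {within @cube R nu, continuous f} ->
  (0 < N)%N -> (0 < P)%N -> 2 * nu%:R <= r * (P%:R * N%:R) ->
  forall x y : 'rV[R]_nu, cube x -> cube y ->
  (forall k, (k < nu)%N -> P%:R * N%:R * `|point_coord x k - point_coord y k| <= 2) ->
  `|f x - f y| <= modulus f r.
Proof.
move=> fc N0 P0 big x y xc yc near; apply: modulus_ge => //.
have pn : 0 < P%:R * N%:R :> R by rewrite mulr_gt0 ?ltr0n.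
apply: (@le_trans _ _ (nu%:R * (2 / (P%:R * N%:R)))).
  apply: eucl_dist_le => [|i]; first by rewrite divr_ge0 // ltW.
  by rewrite ler_pdivlMr // mulrC -!point_coordE near.
by rewrite mulrA ler_pdivrMr // mulrC.
Qed.

(** The cube has diameter at most [nu], so the constant [f 0] suffices at such a radius, on any
    architecture. This covers the small sizes. *)
Lemma constant_approx f (A : arch) (r : R) : {within @cube R nu, continuous f} ->
  nu%:R <= r ->
  exists w, forall x, cube x -> `|f x - net_fun nu A w x| <= 3 * modulus f r.
Proof.
move=> fc nr; have r0 : 0 <= r by apply: le_trans nr.
exists (Weights (fun _ _ _ => 0) (fun _ _ => f 0)) => x xc.
rewrite /net_fun /unit_pre /= big1 ?add0r; last by move=> i _; rewrite mul0r.
have c0 : cube (0 : 'rV[R]_nu) by move=> i; rewrite mxE lexx ler01.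
have d1 : eucl_dist x 0 <= r.
  apply: le_trans nr; rewrite -[leRHS]mulr1; apply: eucl_dist_le => // i.
  by have /andP[? ?] := xc i; rewrite mxE subr0 ger0_norm.
have := modulus_ge fc xc c0 d1; have := modulus_ge0 fc r0; lra.
Qed.

Lemma lower_bound f : {within @cube R nu, continuous f} ->
  exists m, forall x, cube x -> m <= f x.
Proof.
move=> fc; have [b fb] := continuous_cube_bounded fc.
by exists (- b) => x /fb; rewrite ler_norml => /andP[].
Qed.

Lemma fc_approx f (N P H L : nat) (r : R) : {within @cube R nu, continuous f} ->
  (0 < N)%N -> (0 < P)%N -> (2 * nu + 7 <= H)%N -> (1 <= L)%N ->
  (seq_depth nu N P <= L.-1)%N -> 0 <= r -> 2 * nu%:R <= r * (P%:R * N%:R) ->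
  exists w, forall x, cube x -> `|f x - net_fun nu (fc_arch nu H L) w x| <= 3 * modulus f r.
Proof.
move=> fc N0 P0 HH L1 dL r0 big; have [m fm] := lower_bound fc.
have near := near_modulus fc N0 P0 big.
have := sequential_program N0 P0 (modulus_ge0 fc r0) fm near HH (L.-1 - seq_depth nu N P).
rewrite subnKC //.
by apply: (@fc_net R nu H L nu m (fun x v => `|f x - v| <= 3 * modulus f r)); lia.
Qed.

Lemma stack_approx f (N P b H L : nat) (r : R) : {within @cube R nu, continuous f} ->
  (0 < N)%N -> (0 < P)%N -> (nu + 4 + 2 ^ nu * (nu + 3) <= H)%N -> (1 <= L)%N ->
  (cells nu N <= b)%N -> (par_depth nu P <= L.-1)%N ->
  0 <= r -> 2 * nu%:R <= r * (P%:R * N%:R) ->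
  exists w, forall x, cube x -> `|f x - net_fun nu (cell_stack nu b H L) w x| <= 3 * modulus f r.
Proof.
move=> fc N0 P0 HH L1 room dL r0 big; have [m fm] := lower_bound fc.
have near := near_modulus fc N0 P0 big.
have := parallel_program N0 P0 (modulus_ge0 fc r0) fm near HH (L.-1 - par_depth nu P).
rewrite subnKC // => -[cs [bs ok]].
exists (stack_weights N P f m (modulus f r) L cs bs).
by apply: (stack_net nu0 L1 _ room (Q := fun x v => `|f x - v| <= 3 * modulus f r) ok); lia.
Qed.

(** An assignment need not be continuous in [f], so weights may be picked for each [f]
    separately. *)
Lemma approx_bound_choice (A : arch) (c p : R) (W : nat) :
  (forall f, {within @cube R nu, continuous f} -> exists w, forall x, cube x ->
     `|f x - net_fun nu A w x| <= 3 * modulus f (c * W%:R `^ (- p))) ->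
  exists assign, approx_bound nu A assign 3 c W p.
Proof.
move=> h.
have ex f : exists w, {within @cube R nu, continuous f} -> forall x, cube x ->
     `|f x - net_fun nu A w x| <= 3 * modulus f (c * W%:R `^ (- p)).
  have [fc|nfc] := pselect {within @cube R nu, continuous f}.
    by have [w hw] := h f fc; exists w.
  by exists (Weights (fun _ _ _ => 0) (fun _ _ => 0)).
by have [assign ha] := choice ex; exists assign.
Qed.

End Approximation.

(** * Sizes and rates *)

(** Take the largest [N] with [N ^ nu <= m]; since [N.+1 <= 2 * N], the power of [2 * N] already
    exceeds [m]. *)
Lemma nat_root (nu m : nat) : (0 < nu)%N -> (0 < m)%N ->
  exists N, [/\ (0 < N)%N, (N ^ nu <= m)%N & (m < 2 ^ nu * N ^ nu)%N].
Proof.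
move=> nu0 m0.
have ex : exists i, (0 < i)%N && (i ^ nu <= m)%N by exists 1%N; rewrite exp1n.
have bd i : (0 < i)%N && (i ^ nu <= m)%N -> (i <= m)%N.
  case/andP=> i0; apply: leq_trans; by rewrite -{1}[i]expn1 leq_pexp2l.
case: (ex_maxnP ex bd) => N /andP[N0 Nm] maxN; exists N; split=> //.
rewrite -expnMn ltnNge; apply/negP => le.
have : (N.+1 <= N)%N; last by rewrite ltnn.
by apply: maxN; rewrite /= (leq_trans _ le) // leq_exp2r //; lia.
Qed.

Section Rates.
Variables (R : realType) (nu : nat).
Hypothesis nu0 : (0 < nu)%N.

Lemma powR_root_le (x p y : R) : 0 <= x -> 0 <= y ->
  x `^ (p * nu%:R) <= y ^+ nu -> x `^ p <= y.
Proof.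
move=> x0 y0; rewrite powRrM powR_mulrn ?powR_ge0 // => h.
by rewrite ler_pXn2r ?nnegrE ?powR_ge0 in h.
Qed.

Lemma powR_eventually (b y : R) : 0 < b -> 0 <= y ->
  exists W0 : nat, forall W : nat, (W0 <= W)%N -> y <= W%:R `^ b.
Proof.
move=> b0 y0; exists (Num.truncn (y `^ b^-1)).+1 => W W0W.
have -> : y = (y `^ b^-1) `^ b by rewrite -powRrM mulVf ?powRr1 // gt_eqF.
apply: ge0_ler_powR; rewrite ?nnegrE ?powR_ge0 ?ler0n //; first exact: ltW.
have /andP[_ /ltW/le_trans] := truncn_itv (powR_ge0 y b^-1); apply.
by rewrite ler_nat.
Qed.

(** With [M] the resolution [P * N], this turns a lower bound on the resolution by a multiple of
    [W ^ p] into the condition on the radius. *)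
Lemma rate_gap (W : nat) (p K c M a : R) : (1 <= W)%N -> 0 <= a -> 0 <= M ->
  W%:R `^ p <= K * M -> a * K <= c -> a <= c * W%:R `^ (- p) * M.
Proof.
move=> W1 a0 M0 WK aK.
have Wp : 0 < W%:R `^ p :> R by rewrite powR_gt0 // ltr0n.
rewrite powRN mulrAC ler_pdivlMr //.
apply: le_trans (ler_wpM2l a0 WK) _.
by rewrite mulrA ler_wpM2r.
Qed.

Lemma fc_rate (G : nat) : exists c0 : R, 0 < c0 /\ forall c, c0 <= c ->
  forall L W, (1 <= L)%N -> (1 <= W)%N -> (W <= G * L)%N ->
  exists assign, approx_bound nu (fc_arch nu (2 * nu + 10) L) assign 3 c W (2 / nu%:R).
Proof.
(* For [P = N] the program depth is at most [D * N ^ nu]. *)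
pose D := (2 ^ nu * (1 + (nu * 2 + 2) + 2 ^ nu * (nu * 2 + 4)))%N.
have D0 : (0 < D)%N by rewrite muln_gt0 expn_gt0.
pose K := (2 * D * 2 ^ nu * G)%N.
exists (2 * nu%:R * (K ^ 2)%:R + 1); split; first by rewrite ltr_wpDl.
move=> c cK L W L1 W1 WL; apply: approx_bound_choice => f fc.
have c0 : 0 <= c by apply: le_trans cK; rewrite addr_ge0.
have r0 : 0 <= c * W%:R `^ (- (2 / nu%:R)) by rewrite mulr_ge0 ?powR_ge0.
have n0 : nu%:R != 0 :> R by rewrite pnatr_eq0 -lt0n.
have root y : (W <= K * y ^ nu)%N -> W%:R `^ (2 / nu%:R) <= (K ^ 2)%:R * (y%:R * y%:R) :> R.
  move=> WKy; apply: powR_root_le => //.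
  rewrite divfK // powR_mulrn // -!natrM -!natrX ler_nat.
  rewrite mulnn -expnMn expnAC leq_exp2r // expnMn (leq_trans WKy) //.
  rewrite leq_mul2r -{1}[K]expn1; apply/orP; right; apply: leq_pexp2l => //.
  by case: (K) WKy W1 => //; lia.
(* A network with fewer than [D] program layers has [W <= K]; the radius is then at least [nu] and a
   constant suffices. *)
case: (ltnP L.-1 D) => LD.
  apply: constant_approx => //.
  rewrite -[leRHS]mulr1 -[X in _ * X](mulr1 1).
  apply: (@rate_gap _ _ (K ^ 2)%:R) => //.
    apply: (root 1%N); rewrite exp1n muln1; apply: (leq_trans WL).
    rewrite /K mulnC leq_mul //; apply: leq_trans (leq_pmulr _ _); rewrite ?expn_gt0 //; lia.
  apply: le_trans cK; rewrite -[leLHS]addr0 lerD // ler_wpM2r // ler_peMl //.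
  by rewrite ler1n.
have [|N [N0 Nm mN]] := @nat_root nu (L.-1 %/ D) nu0; first by rewrite divn_gt0.
apply: (fc_approx nu0 fc N0 N0) => //; first by lia.
  apply: leq_trans (leq_trans (leq_mul Nm (leqnn D)) (leq_trunc_div _ _)).
  rewrite /seq_depth /walk_len /cells expnMn /D.
  have : (0 < N ^ nu)%N by rewrite expn_gt0 N0.
  move: (N ^ nu)%N (2 ^ nu)%N => a b a0; nia.
apply: (@rate_gap _ _ (K ^ 2)%:R) => //; last by apply: le_trans cK; rewrite ler_wpDr.
apply: root; apply: (leq_trans WL).
have : (L.-1 < (L.-1 %/ D).+1 * D)%N by rewrite -ltn_divLR.
rewrite /K; move: (L.-1 %/ D)%N (N ^ nu)%N (2 ^ nu)%N Nm mN => m a b Nm mN Lm.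
have : (L <= 2 * D * (b * a))%N by nia.
nia.
Qed.

End Rates.

(** * Distributing the weights of a stacked network *)

Section StackRate.
Variables (R : realType) (nu : nat).
Hypothesis nu0 : (0 < nu)%N.

Lemma stack_rate (p : R) : 1 / nu%:R < p < 2 / nu%:R ->
  exists (c0 : R) (K W0 : nat), 0 < c0 /\ forall W, (W0 <= W)%N ->
    let H := (3 ^ nu * (2 * nu + 10))%N in
    let L := Num.truncn (W%:R `^ (p * nu%:R - 1)) in
    exists b, let A := cell_stack nu b H L in
      [/\ (1 <= L)%N, wf_arch nu A, (num_weights A <= W < num_weights A + K)%N &
        forall c, c0 <= c -> exists assign, approx_bound nu A assign 3 c W p].
Proof.
move=> /andP[p1 p2].
have fixed_bound (x y z l : nat) : (0 < l)%N -> (2 * (x + l.-1 * y + z) <= 2 * (x + y + z) * l)%N.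
  by case: l => // l _; rewrite /= -mulnA leq_mul2l /= mulnS; nia.
have cells_bound (W fx b k d a : nat) :
    (2 * fx <= W)%N -> (W - fx < b.+1 * k)%N -> (0 < b)%N -> (b < d * a)%N ->
    (W <= 4 * k * d * a)%N.
  move=> fW Wb b0 ba; have : (W <= 2 * (b.+1 * k))%N by lia.
  have : (b.+1 * k <= (2 * (d * a)) * k)%N by rewrite leq_mul2r; apply/orP; right; lia.
  by lia.
have depth_bound (l m k d a : nat) :
    (l.-1 < m.+1 * k)%N -> (0 < m)%N -> (0 < k)%N -> (m < d * a)%N ->
    (l.+1 <= 3 * k * d * a)%N.
  move=> lm m0 k0 ma; have : (m.+1 * k <= d * a * k)%N by rewrite leq_mul2r ma orbT.
  have : (0 < m * k)%N by rewrite muln_gt0 m0.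
  by rewrite mulSn in lm *; lia.
have count_bound (w k x b : nat) : (2 * x <= w)%N -> (b * k <= w - x)%N ->
    (w - x < b.+1 * k)%N -> (b * k + x <= w < b * k + x + k)%N.
  by rewrite mulSn => ? ? ?; apply/andP; split; lia.
have depth_eq (x y z : nat) : (x * (x * y * z) = y * (x * (x * z)))%N by ring.
have prod_bound (x y s t : nat) : (0 < x)%N -> (0 < y)%N ->
    ((x * s ^ nu) * (y * t ^ nu) <= (x * y * (t * s)) ^ nu)%N.
  move=> x0 y0; rewrite !expnMn mulnACA (mulnC (t ^ nu)%N) leq_mul // leq_mul //.
    by rewrite -{1}[x]expn1 leq_pexp2l.
  by rewrite -{1}[y]expn1 leq_pexp2l.
have half_bound (w k x : nat) : (2 * k <= w)%N -> (2 * x <= w)%N -> (k <= w - x)%N.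
  by lia.
have n0 : 0 < nu%:R :> R by rewrite ltr0n.
(* The bound [1 / nu < p] gives [al > 0], so the depth grows; [p < 2 / nu] gives [al < 1], so the
   narrow part, whose weights are of order [W ^ al], eventually takes at most half of [W]. *)
pose al := p * nu%:R - 1.
have al0 : 0 < al by rewrite /al subr_gt0 -ltr_pdivrMr.
have al1 : 0 < 1 - al by rewrite /al opprB addrA subr_gt0 -ltr_pdivlMr.
pose H := (3 ^ nu * (2 * nu + 10))%N.
have H_big : (nu + 4 + 2 ^ nu * (nu + 3) <= H)%N.
  have : (2 ^ nu <= 3 ^ nu)%N by rewrite leq_exp2r.
  have : (0 < 3 ^ nu)%N by rewrite expn_gt0.
  rewrite /H; move: (2 ^ nu)%N (3 ^ nu)%N => a b; nia.
pose K := (nu * 2 * 2 + (nu * 2).+1 * 2 + 2 * H)%N.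
have K0 : (0 < K)%N by rewrite /K; lia.
pose F := (nu.+1 * H + H * H.+1 + H.+1)%N.
pose D := (2 ^ nu * (2 ^ nu * (nu * 2 + 4)))%N.
have D0 : (0 < D)%N by rewrite !muln_gt0 !expn_gt0 /=; lia.
pose K1 := (4 * K * 2 ^ nu)%N.
pose K2 := (3 * D * 2 ^ nu)%N.
have [Wa Wa_ok] := @powR_eventually R al D.+2%:R al0 (ler0n _ _).
have [Wb Wb_ok] := @powR_eventually R (1 - al) (2 * F)%:R al1 (ler0n _ _).
exists (2 * nu%:R * (K1 * K2)%:R + 1), K, (maxn (2 * K) (maxn Wa Wb)).
split=> [|W]; first by rewrite ltr_wpDl.
rewrite !geq_max => /andP[WK /andP[/Wa_ok Wal /Wb_ok Wbe]].
have W0 : (0 < W)%N by lia.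
move=> H' L; rewrite /H' -/H; clear H'.
have /andP[Ll Lu] := truncn_itv (powR_ge0 (W%:R : R) al).
rewrite -/L in Ll Lu.
have LD : (D.+2 <= L)%N.
  by rewrite -ltnS -(ltr_nat R); apply: le_lt_trans Wal Lu.
pose fixed := (nu.+1 * H + L.-1 * (H * H.+1) + H.+1)%N.
have fixed_le : (2 * fixed <= W)%N.
  apply: (@leq_trans (2 * F * L)%N); first by apply: fixed_bound; exact: leq_trans LD.
  rewrite -(ler_nat R) natrM; apply: (@le_trans _ _ (W%:R `^ (1 - al) * W%:R `^ al)).
    by apply: ler_pM.
  by rewrite -powRD ?subrK ?powRr1 //; apply/implyP; rewrite pnatr_eq0 -lt0n.
(* All weights left by the narrow part go to blocks; the remainder is below [K], the cost of one
   block. *)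
pose b := ((W - fixed) %/ K)%N.
have b_lo : (b * K <= W - fixed)%N by apply: leq_trunc_div.
have b_hi : (W - fixed < b.+1 * K)%N by rewrite -ltn_divLR.
have b0 : (0 < b)%N by rewrite divn_gt0 //; apply: half_bound.
have L1 : (1 <= L)%N by apply: leq_trans LD.
exists b; split=> //.
- exact: cell_stack_wf.
- by rewrite cell_stack_weights // -/K -/fixed; apply: count_bound.
move=> c cK; apply: approx_bound_choice => f fc.
have c0 : 0 <= c by apply: le_trans cK; rewrite addr_ge0.
have r0 : 0 <= c * W%:R `^ (- p) by rewrite mulr_ge0 ?powR_ge0.
(* One block per cell makes [N ^ nu] of order [b]; the depth makes [P ^ nu] of order [L]. Their
   product has the order of [W ^ (1 + al)], which is [W ^ (p * nu)]. *)
have [N [N0 Nb bN]] := nat_root nu0 b0.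
have m0 : (0 < L.-1 %/ D)%N.
  by rewrite divn_gt0 // -ltnS prednK // (leq_trans _ LD).
have [P [P0 Pm mP]] := nat_root nu0 m0.
apply: (stack_approx nu0 fc N0 P0) => //.
  apply: leq_trans (leq_trans (leq_mul Pm (leqnn D)) (leq_trunc_div _ _)).
  by rewrite /par_depth /walk_len expnMn /D depth_eq.
apply: (@rate_gap _ _ _ (K1 * K2)%:R) => //; last by apply: le_trans cK; rewrite ler_wpDr.
apply: (powR_root_le nu0) => //.
have -> : p * nu%:R = 1 + al by rewrite /al addrC subrK.
rewrite powRD; last by apply/implyP; rewrite pnatr_eq0 -lt0n.
rewrite powRr1 //.
have h1 : (W <= K1 * N ^ nu)%N.
  exact: cells_bound fixed_le b_hi b0 bN.
(* With [L.+1], because truncation only gives [W ^ al < L + 1]. *)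
have h2 : (L.+1 <= K2 * P ^ nu)%N.
  by apply: (@depth_bound L (L.-1 %/ D)%N) => //; exact: ltn_ceil.
apply: (@le_trans _ _ (((K1 * N ^ nu) * (K2 * P ^ nu))%N%:R)).
  rewrite natrM; apply: ler_pM; rewrite ?powR_ge0 ?ler_nat //.
  by apply: le_trans (ltW Lu) _; rewrite ler_nat.
rewrite -!natrM -natrX ler_nat; apply: prod_bound.
  by rewrite /K1 muln_gt0 expn_gt0 muln_gt0 K0.
by rewrite /K2 muln_gt0 expn_gt0 muln_gt0 D0.
Qed.

End StackRate.

(** * Well-formedness and size of the fully connected architecture *)

Section FullyConnected.
Variables (nu H L : nat).
Hypothesis L1 : (1 <= L)%N.

Lemma fc_arch_layer0 : nth [::] (hidden_layers (fc_arch nu H L)) 0 =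
  nseq H [seq (0%N, k) | k <- iota 0 nu].
Proof. by rewrite /= nth_mkseq. Qed.

Lemma fc_arch_layerS l : (l.+1 < L)%N -> nth [::] (hidden_layers (fc_arch nu H L)) l.+1 =
  nseq H [seq (l.+1, k) | k <- iota 0 H].
Proof. by move=> lL; rewrite /= nth_mkseq. Qed.

Lemma fc_arch_depth : depth (fc_arch nu H L) = L.
Proof. by rewrite /depth size_mkseq. Qed.

Lemma fc_arch_size j : (j <= L)%N ->
  layer_size nu (fc_arch nu H L) j = if j == 0%N then nu else H.
Proof.
case: j => [|[|j]] jL //; rewrite /layer_size [_ == _]/= [_.-1]/=.
  by rewrite fc_arch_layer0 size_nseq.
by rewrite fc_arch_layerS // size_nseq.
Qed.

Lemma fc_arch_wf : wf_arch nu (fc_arch nu H L).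
Proof.
have uniq_layer j n : uniq [seq (j, k) : src | k <- iota 0 n].
  by rewrite map_inj_uniq ?iota_uniq // => a b [].
rewrite /wf_arch fc_arch_depth; split; last split; last first.
- by move=> s /mapP[k]; rewrite mem_iota => /= kH ->; rewrite fc_arch_size // leqnn gtn_eqF.
- exact: uniq_layer.
move=> [|l] lL u.
- rewrite fc_arch_layer0 mem_nseq => /andP[_ /eqP ->]; split; first exact: uniq_layer.
  by move=> s /mapP[k]; rewrite mem_iota => /= kn ->.
- rewrite fc_arch_layerS // mem_nseq => /andP[_ /eqP ->]; split; first exact: uniq_layer.
  move=> s /mapP[k]; rewrite mem_iota => /= kn ->.
  by rewrite fc_arch_size //= ltnW.
Qed.

(** The indexing count [fc_W] exceeds the actual number of weights by [2 * H ^ 2]. *)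
Lemma fc_arch_weights : (num_weights (fc_arch nu H L) <= fc_W nu H L)%N.
Proof.
rewrite /num_weights size_map size_iota /fc_W.
have -> : sumn [seq sumn [seq (size u).+1 | u <- layer] | layer <- hidden_layers (fc_arch nu H L)]
    = (H * nu.+1 + L.-1 * (H * H.+1))%N; last by nia.
rewrite -(prednK L1) /= /mkseq -map_comp map_nseq sumn_nseq size_map size_iota.
rewrite mulnC; congr (_ + _)%N.
set F := (_ \o _).
suff gen n k : (0 < k)%N -> sumn [seq F i | i <- iota k n] = (n * (H * H.+1))%N by exact: gen.
elim: n k => //= n IH k k0; rewrite IH // /F /= (gtn_eqF k0).
by rewrite map_nseq sumn_nseq size_map size_iota mulSn [(H * H.+1)%N]mulnC.
Qed.

End FullyConnected.

(** * Padding to an exact number of weights *)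

Section Padding.
Variables (nu : nat) (A : arch) (k : nat).

(** The added layer has [k] units without connections in or out; each costs exactly one weight, its
    bias. *)
Definition padded : arch := Arch (rcons (hidden_layers A) (nseq k [::])) (out_srcs A).

Lemma padded_depth : depth padded = (depth A).+1.
Proof. by rewrite /depth size_rcons. Qed.

Lemma padded_weights : num_weights padded = (num_weights A + k)%N.
Proof.
rewrite /num_weights /= map_rcons sumn_rcons map_nseq sumn_nseq /=; lia.
Qed.

Lemma padded_layer l : (l < depth A)%N ->
  nth [::] (hidden_layers padded) l = nth [::] (hidden_layers A) l.
Proof. by move=> lA; rewrite /= nth_rcons -/(depth A) lA. Qed.

Lemma padded_size j : (j <= depth A)%N -> layer_size nu padded j = layer_size nu A j.
Proof. by case: j => // j jA; rewrite /layer_size /= -/(depth A) nth_rcons -/(depth A) jA. Qed.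

Lemma padded_wf : wf_arch nu A -> wf_arch nu padded.
Proof.
move=> [hid [uo out]]; rewrite /wf_arch padded_depth; split; last split => //.
  move=> l; rewrite ltnS leq_eqVlt => /orP[/eqP ->|lA] u.
    by rewrite /= nth_rcons -/(depth A) ltnn eqxx mem_nseq => /andP[_ /eqP ->].
  rewrite padded_layer // => uA; have [uu us] := hid l lA u uA; split=> // s su.
  by have [s1 s2] := us s su; rewrite padded_size // (leq_trans s1) // ltnW.
move=> s /out[s1 s2]; rewrite padded_size //; split=> //; exact: leqW.
Qed.

Lemma padded_net (R : realType) (w : weights R) :
  wf_arch nu A ->
  exists w' : weights R, forall x : 'rV[R]_nu, net_fun nu padded w' x = net_fun nu A w x.
Proof.
move=> [hid [_ out]].
(* The extra layer moves the output unit up by one level, so its weights are looked up one level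
   below. *)
pose up l := if l == (depth A).+2 then (depth A).+1 else l.
exists (Weights (fun l => wt w (up l)) (fun l => bias w (up l))) => x.
set w' := Weights _ _.
have vals l : (l <= depth A)%N -> layer_vals padded w' x l = layer_vals A w x l.
  elim: l => //= l IH lA; rewrite IH 1?ltnW // nth_rcons -/(depth A) lA.
  congr rcons; apply/eq_map => i; congr relu; rewrite /unit_pre /= /up ifF //; lia.
rewrite /net_fun padded_depth.
rewrite !unit_preE; [|by move=> s /out[]|by move=> s /out[/leqW]].
rewrite /= /up eqxx; congr (_ + _); apply: eq_bigr => i _; congr (_ * _).
have [s1 _] := out _ (mem_nth (0%N, 0%N) (ltn_ord i)).
by rewrite /layer_out vals.
Qed.

End Padding.

(** * From large sizes to all sizes *)

Section AllSizes.
Variables (R : realType) (nu : nat).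

Lemma padded_approx (A : arch) (k : nat) (a c p : R) (W : nat) : wf_arch nu A ->
  (exists assign, approx_bound nu A assign a c W p) ->
  exists assign, approx_bound nu (padded A k) assign a c W p.
Proof.
move=> Awf [assign ok].
have /choice[up upE] : forall w : weights R, exists w', forall x : 'rV[R]_nu,
    net_fun nu (padded A k) w' x = net_fun nu A w x by move=> w; apply: padded_net.
by exists (up \o assign) => f fc x xc; rewrite upE; apply: ok.
Qed.

Lemma eventually_all (p : R) : 0 < p -> 0 <= p * nu%:R - 1 ->
  (exists (c0 C : R) (W0 : nat), forall W, (W0 <= W)%N -> exists A,
     [/\ wf_arch nu A, (num_weights A <= W)%N, (depth A)%:R <= C * W%:R `^ (p * nu%:R - 1) &
         forall c, c0 <= c -> exists assign, approx_bound nu A assign 3 c W p]) ->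
  exists (a c C : R) (eta : nat -> arch)
         (assign : nat -> ('rV[R]_nu -> R) -> weights R),
    0 < a /\ 0 < c /\
    forall W : nat, (1 <= W)%N ->
      wf_arch nu (eta W) /\ num_weights (eta W) = W /\
      (depth (eta W))%:R <= C * powR (W%:R) (p * nu%:R - 1) /\
      approx_bound nu (eta W) (assign W) a c W p.
Proof.
move=> p0 al0 [c0 [C [W0 large]]].
(* Chosen so that the radius is at least [nu] for every [W] below [W0]. *)
pose c1 := nu%:R * W0%:R `^ p + 1.
have c1_gt0 : 0 < c1 by rewrite ltr_wpDl // mulr_ge0 ?powR_ge0.
pose c := Num.max c0 c1.
have c_gt0 : 0 < c by rewrite lt_max c1_gt0 orbT.
pose C' := Num.max C 0 + 1.
have ex W : exists Aw : arch * (('rV[R]_nu -> R) -> weights R), (1 <= W)%N ->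
    [/\ wf_arch nu Aw.1, num_weights Aw.1 = W,
      (depth Aw.1)%:R <= C' * W%:R `^ (p * nu%:R - 1) & approx_bound nu Aw.1 Aw.2 3 c W p].
  case: (ltnP 0 W) => [W1|W0']; last first.
    by exists (Arch [::] [::], fun=> Weights (fun _ _ _ => 0) (fun _ _ => 0)).
  (* Pays for the layer added by padding; this is the [+ 1] in [C']. *)
  have one : 1 <= W%:R `^ (p * nu%:R - 1).
    rewrite -[leLHS](powRr0 W%:R); apply: ler_powR => //; by rewrite ler1n.
  suff [A [Awf AW Ad [assign ok]]] : exists A, [/\ wf_arch nu A, (num_weights A <= W)%N,
      (depth A)%:R <= Num.max C 0 * W%:R `^ (p * nu%:R - 1) &
      exists assign, approx_bound nu A assign 3 c W p].
    have [assign' ok'] := padded_approx (W - num_weights A) Awf (ex_intro _ assign ok).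
    exists (padded A (W - num_weights A), assign') => _ /=; split=> //.
    - exact: padded_wf.
    - by rewrite padded_weights subnKC.
    - by rewrite padded_depth -natr1 /C' mulrDl mul1r lerD.
  case: (leqP W0 W) => WW0.
    have [A [Awf AW Ad ok]] := large W WW0; exists A; split=> //.
      by apply: le_trans Ad _; rewrite ler_wpM2r ?powR_ge0 // le_max lexx.
    by apply: ok; rewrite le_max lexx.
  (* Below [W0]: no hidden layers, and the output bias as the only weight. *)
  exists (Arch [::] [::]); split=> //.
    by rewrite mulr_ge0 ?powR_ge0 // le_max lexx orbT.
  apply: approx_bound_choice => f fc; apply: constant_approx => //.
  rewrite -[leRHS]mulr1; apply: (@rate_gap _ _ _ (W0%:R `^ p)) => //.
    rewrite mulr1; apply: ge0_ler_powR; rewrite ?nnegrE ?ler0n //; first exact: ltW.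
    by rewrite ler_nat ltnW.
  by rewrite le_max /c1 lerDl ler01 orbT.
have /choice[Aw AwP] := ex.
exists 3, c, C', (fun W => (Aw W).1), (fun W => (Aw W).2); split; first by [].
by split=> // W /AwP[].
Qed.

End AllSizes.

Unset Implicit Arguments.

Theorem theorem3 (R : realType) (nu : nat) (hnu : (1 <= nu)%N) :
  (* (a) *)
  (forall p : R, 1 / nu%:R < p <= 2 / nu%:R ->
    exists (a c C : R) (eta : nat -> arch)
           (assign : nat -> ('rV[R]_nu -> R) -> weights R),
      0 < a /\ 0 < c /\
      forall W : nat, (1 <= W)%N ->
        wf_arch nu (eta W) /\ num_weights (eta W) = W /\
        (depth (eta W))%:R <= C * powR (W%:R) (p * nu%:R - 1) /\
        approx_bound nu (eta W) (assign W) a c W p)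
  /\
  (* (b) p = 2/nu, narrow fully-connected architectures of width 2nu+10 *)
  (exists (a c : R) (assign : nat -> ('rV[R]_nu -> R) -> weights R),
      0 < a /\ 0 < c /\
      forall L : nat, (1 <= L)%N ->
        approx_bound nu (fc_arch nu (2 * nu + 10) L) (assign L) a c
                     (fc_W nu (2 * nu + 10) L) (2 / nu%:R))
  /\
  (* (c) 1/nu < p < 2/nu, stacked architectures *)
  (exists B : block,
    forall p : R, 1 / nu%:R < p < 2 / nu%:R ->
    exists (a c : R) (K W0 : nat) (m : nat -> nat) (glue : nat -> seq (seq src))
           (assign : nat -> ('rV[R]_nu -> R) -> weights R),
      0 < a /\ 0 < c /\
      forall W : nat, (W0 <= W)%N ->
        let L := Num.truncn (powR (W%:R) (p * nu%:R - 1)) in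
        let A := stack_arch B (m W) (3 ^ nu * (2 * nu + 10)) L (glue W) in
        size (glue W) = (3 ^ nu * (2 * nu + 10))%N /\
        wf_arch nu A /\
        (num_weights A <= W < num_weights A + K)%N /\
        approx_bound nu A (assign W) a c W p).
Proof.
have n0 : 0 < nu%:R :> R by rewrite ltr0n.
split; last split.
- move=> p /andP[p1]; rewrite le_eqVlt => /orP p2.
  have p0 : 0 < p by apply: lt_trans p1; rewrite divr_gt0.
  have al0 : 0 <= p * nu%:R - 1 by rewrite subr_ge0 -ler_pdivrMr // ltW.
  (* For [p < 2 / nu] the stacked networks serve, for [p = 2 / nu] the narrow ones. *)
  apply: eventually_all => //; case: p2 => [/eqP pE|p2]; last first.
    have [|c0 [K [W0 [_ rate]]]] := @stack_rate R nu hnu p; first by rewrite p1.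
    (* The depth is [L + 2], hence at most [3 * L]. *)
    exists c0, 3, W0 => W /rate[b [L1 Awf /andP[AW _] ok]].
    eexists; split; [exact: Awf|exact: AW| |exact: ok].
    rewrite cell_stack_depth //.
    set y := W%:R `^ _; have y0 : 0 <= y := powR_ge0 _ _.
    have /andP[Ly _] := truncn_itv y0.
    have : 1 <= (Num.truncn y)%:R :> R by rewrite ler1n.
    by rewrite -2!natr1; lra.
  (* Depth [L] costs at most [G * L] weights, so [L = W %/ G] fits, and
     [W < (L + 1) * G <= 2 * G * L] explains the constant [2 * G]. *)
  pose H := (2 * nu + 10)%N; pose G := (fc_W nu H 1).
  have G0 : (0 < G)%N by rewrite /G /fc_W addn1.
  have [c0 [_ rate]] := @fc_rate R nu hnu (2 * G).
  exists c0, 1, (2 * G)%N => W WG.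
  pose L := (W %/ G)%N.
  have L1 : (1 <= L)%N by rewrite divn_gt0 //; lia.
  have LW : (L * G <= W)%N by apply: leq_trunc_div.
  exists (fc_arch nu H L); split.
  + exact: fc_arch_wf.
  + apply: leq_trans LW; apply: leq_trans (fc_arch_weights _ _ _) _ => //.
    by rewrite /G /fc_W; nia.
  + rewrite fc_arch_depth mul1r pE divfK ?gt_eqF // (_ : 2 - 1 = 1 :> R); last by ring.
    by rewrite powRr1 // ler_nat; apply: leq_trans LW; rewrite leq_pmulr.
  + move=> c cc0; rewrite pE; apply: rate => //; first by lia.
    have : (W < L.+1 * G)%N by rewrite -ltn_divLR.
    rewrite mulSn; nia.
- pose H := (2 * nu + 10)%N.
  have [c0 [c0_gt0 rate]] := @fc_rate R nu hnu (fc_W nu H 1).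
  have ex L : exists assign, (1 <= L)%N ->
      approx_bound nu (fc_arch nu H L) assign 3 c0 (fc_W nu H L) (2 / nu%:R).
    case: (ltnP 0 L) => [L1|]; last by exists (fun=> Weights (fun _ _ _ => 0) (fun _ _ => 0)).
    have [||assign ok] := rate c0 (lexx _) L (fc_W nu H L) L1; last by exists assign.
      by rewrite /fc_W addn1.
    by rewrite /fc_W; nia.
  by have /choice[assign ok] := ex; exists 3, c0, assign.
- exists (cell_block nu) => p pp.
  have [c0 [K [W0 [c0_gt0 rate]]]] := @stack_rate R nu hnu p pp.
  set H := (3 ^ nu * (2 * nu + 10))%N.
  have ex W : exists ba : nat * (('rV[R]_nu -> R) -> weights R), (W0 <= W)%N ->
      let A := cell_stack nu ba.1 H (Num.truncn (W%:R `^ (p * nu%:R - 1))) in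
      [/\ wf_arch nu A, (num_weights A <= W < num_weights A + K)%N &
        approx_bound nu A ba.2 3 c0 W p].
    case: (leqP W0 W) => [/rate[b [_ Awf AW ok]]|_]; last first.
      by exists (0%N, fun=> Weights (fun _ _ _ => 0) (fun _ _ => 0)).
    by have [assign okA] := ok c0 (lexx _); exists (b, assign).
  have /choice[ba baP] := ex.
  exists 3, c0, K, W0, (fun W => (ba W).1), (fun W => nseq H (glue_srcs nu (ba W).1)),
    (fun W => (ba W).2); do 2?split => //.
  move=> W /baP[Awf AW ok]; split; first by rewrite size_nseq.
  by split.
Qed.
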